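(* Let $T>0$, $s>5/2$, and let $f:\mathbb R\to\mathbb R$ be a $C^\infty$ function with $f(0)=0$. Let $u_1,u_2$ be real-valued solutions of the periodic generalized Benjamin-Ono equation $$\partial_tu-\mathcal H\partial_x^2u+\partial_xf(u)=0,\qquad (x,t)\in\mathbb S^1\times[0,T],$$ (each with its own initial datum $u_j(\cdot,0)$) such that $$u_1,u_2\in C([0,T]:H^s(\mathbb S^1))\cap C^1((0,T):H^{s-2}(\mathbb S^1)).$$ If there exists a nonempty open set $\Omega\subset\mathbb S^1\times[0,T]$ such that $u_1(x,t)=u_2(x,t)$ for all $(x,t)\in\Omega$, then $u_1(x,t)=u_2(x,t)$ for all $(x,t)\in\mathbb S^1\times[0,T]$. In particular, if $u_1$ vanishes in $\Omega$, then $u_1\equiv0$.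
   Context: $\mathbb S^1\simeq\mathbb R/\mathbb Z$ is the circle and $H^s(\mathbb S^1)$ the usual $L^2$-based periodic Sobolev space. $\mathcal H$ is the periodic Hilbert transform, the Fourier multiplier $\widehat{\mathcal Hg}(n)=-i\,\mathrm{sgn}(n)\,\widehat g(n)$, $n\in\mathbb Z$, with $\mathrm{sgn}(0)=0$. $C([0,T]:X)$ and $C^1((0,T):X)$ denote continuous, respectively continuously differentiable, functions of $t$ with values in the Banach space $X$. Under the stated regularity the equation holds pointwise. *)

(* Defs.v *)
(* MathComp-Analysis development, over an arbitrary real number type R : realType. *)
From mathcomp Require Export all_boot all_order all_algebra.
From mathcomp Require Export all_classical all_reals all_analysis.
From mathcomp Require Export complex.

Set Implicit Arguments.
Unset Strict Implicit.
Unset Printing Implicit Defensive.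
Import Order.TTheory GRing.Theory Num.Theory.
Import numFieldNormedType.Exports.

Local Open Scope classical_set_scope.
Local Open Scope ring_scope.

(* Functions on the circle R/Z are encoded as 1-periodic functions on R, and
   [0, 1] serves as a fundamental domain. *)

Definition L2_circle (R : realType) (g : R -> R) : Prop :=
  [/\ periodic g 1, measurable_fun setT g &
      (@lebesgue_measure R).-integrable `[0, 1]
        (fun x => (g x ^+ 2)%:E)].

(* The integral over [0, 1] of g(x) exp(- 2 i pi n x), for real-valued g. *)
Definition fourier (R : realType) (g : R -> R) (n : int) : R[i] :=
  Complex
    (\int[@lebesgue_measure R]_(x in `[0, 1]) (g x * cos (2 * pi * n%:~R * x)))
    (- \int[@lebesgue_measure R]_(x in `[0, 1])
         (g x * sin (2 * pi * n%:~R * x))).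

Definition sobolev_norm (R : realType) (s : R) (g : R -> R) : \bar R :=
  sqrte (\esum_(n in [set: int])
    ((1 + n%:~R ^+ 2) `^ s * ComplexField.Normc.normc (fourier g n) ^+ 2)%:E).

(* H^s of the circle, for s >= 0 only: for negative s this set would miss the
   elements of H^s that are not functions.  As usual, two functions equal
   almost everywhere represent the same element. *)
Definition sobolev (R : realType) (s : R) (g : R -> R) : Prop :=
  L2_circle g /\ (sobolev_norm s g < +oo)%E.

(* Time-dependent functions are written u t x, with time first. *)

(* u belongs to C(I : H^s). *)
Definition sobolev_continuous (R : realType) (s : R) (I : set R)
    (u : R -> R -> R) : Prop :=
  (forall t : R, I t -> sobolev s (u t)) /\
  (forall t : R, I t ->
     sobolev_norm s (u t' \- u t) @[t' --> within I (nbhs t)] --> 0%E).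

(* v is the H^s-valued derivative of u at time t. *)
Definition sobolev_is_derive (R : realType) (s : R) (u : R -> R -> R)
    (t : R) (v : R -> R) : Prop :=
  sobolev_norm s (fun x => h^-1 * (u (t + h) x - u t x) - v x)
    @[h --> 0^'] --> 0%E.

(* u belongs to C^1((a, b) : H^s). *)
Definition sobolev_C1 (R : realType) (s a b : R) (u : R -> R -> R) : Prop :=
  (forall t : R, t \in `]a, b[ -> sobolev s (u t)) /\
  exists v : R -> R -> R,
    sobolev_continuous s `]a, b[ v /\
    forall t : R, t \in `]a, b[ -> sobolev_is_derive s u t (v t).

(* h represents the periodic Hilbert transform of g, as an operator on L^2. *)
Definition is_hilbert (R : realType) (g h : R -> R) : Prop :=
  [/\ L2_circle g, L2_circle h &
      forall n : int,
        fourier h n = - 'i%C * (sgz n)%:~R * fourier g n].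

Definition smooth (R : realType) (f : R -> R) : Prop :=
  forall (n : nat) (x : R), derivable (f^`(n))%classic x 1.

(* The equation d_t u - H d_x^2 u + d_x f(u) = 0, pointwise on R/Z x (0, T);
   the open time interval is where u is assumed differentiable in time.
   Continuity of h selects the pointwise values of H d_x^2 u. *)
Definition bo_equation (R : realType) (T : R) (f : R -> R)
    (u : R -> R -> R) : Prop :=
  forall t : R, t \in `]0, T[ ->
    exists h : R -> R,
      [/\ continuous h, is_hilbert ((u t)^`(2))%classic h &
          forall x,
            ((u ^~ x)^`())%classic t - h x + ((f \o u t)^`())%classic x = 0].

(* A solution in C([0, T] : H^s) with d_t u in H^(s - 2); since s > 1/2 in use,
   each u t is taken to be the continuous representative of its class. *)
Definition bo_solution (R : realType) (T s : R) (f : R -> R)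
    (u : R -> R -> R) : Prop :=
  [/\ forall t : R, t \in `[0, T] -> continuous (u t),
      sobolev_continuous s `[0, T] u,
      sobolev_C1 (s - 2) 0 T u &
      bo_equation T f u].

(* Omega, a set of pairs (x, t), is the lift to R x [0, T] of a relatively open
   subset of R/Z x [0, T]. *)
Definition open_cylinder (R : realType) (T : R) (Omega : set (R * R)) : Prop :=
  (forall x t : R, Omega (x + 1, t) <-> Omega (x, t)) /\
  exists2 O : set (R * R), open O &
    Omega = O `&` [set p | p.2 \in `[0, T]].

(* Main.v *)
(* At a time met by Omega the difference w = u1 - u2 vanishes on an arc, and so
   do w'' and, by the equation, its Hilbert transform.  Since w'' + i H w'' has
   no negative frequencies it is the boundary value of a power series vanishing
   on an arc, hence zero; so w'' = 0, w is constant and w = 0 at that time.  The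
   energy \int w ^ 2 has derivative 2 \int w w_t, in which the dispersive term
   w H w'' integrates to zero and the nonlinear one is O(\int w ^ 2) after an
   integration by parts.  Gronwall's inequality, forwards and backwards in time,
   propagates w = 0 to all times.  The condition s > 5/2 makes the Fourier series
   of w'' and w_t absolutely convergent, so all this is classical calculus. *)
Require Import Defs.
From mathcomp Require Import measurable_realfun ring lra.

Import Order.TTheory GRing.Theory Num.Theory.
Import numFieldNormedType.Exports.
Local Open Scope classical_set_scope.
Local Open Scope ring_scope.
Set Implicit Arguments.
Unset Strict Implicit.
Unset Printing Implicit Defensive.

(** * Integration over one period *)

(** Boundary uniqueness is reduced to polynomials. By absolute convergence the partial sums of the
    power series are uniformly small on the arc. Finitely many rotated copies of one partial sum are
    multiplied, so that at each point of the circle some factor is small, while the mean of the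
    product over enough roots of unity is exactly a power of the constant coefficient. That
    coefficient is therefore 0, and division by z passes to the next one. The number 5/2 comes from
    one Cauchy-Schwarz estimate: the sum of (1 + n^2)^r |g_n| is controlled by the H^s norm once the
    sum of (1 + n^2)^(2r - s) converges, that is, when s - 2r > 1/2. It is applied with r = 1 in H^s
    for the solution and with r = 0 in H^(s - 2) for its time derivative. The second use makes the
    difference quotients in time converge uniformly in x, so that their limit is the pointwise
    derivative in the equation and the energy can be differentiated under the integral. The energy
    argument runs on open time intervals; the end points follow by continuity. *)

Definition int01 (R : realType) (g : R -> R) : R :=
  \int[@lebesgue_measure R]_(x in `[0, 1]) g x.

Definition integrable01 (R : realType) (g : R -> R) : Prop :=
  (@lebesgue_measure R).-integrable `[0, 1] (EFin \o g).

Lemma continuous_fun_cst (R : realType) (c : R) : continuous (fun _ : R => c).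
Proof. by move=> x; exact: cvg_cst. Qed.

Lemma continuous_fun_id (R : realType) : continuous (fun x : R => x).
Proof. by move=> x; exact: cvg_id. Qed.

Lemma continuous_funD (R : realType) (f g : R -> R) :
  continuous f -> continuous g -> continuous (fun x => f x + g x).
Proof. by move=> cf cg x; exact: cvgD (cf x) (cg x). Qed.

Lemma continuous_funB (R : realType) (f g : R -> R) :
  continuous f -> continuous g -> continuous (fun x => f x - g x).
Proof. by move=> cf cg x; exact: cvgB (cf x) (cg x). Qed.

Lemma continuous_funN (R : realType) (f : R -> R) :
  continuous f -> continuous (fun x => - f x).
Proof. by move=> cf x; exact: cvgN (cf x). Qed.

Lemma continuous_funM (R : realType) (f g : R -> R) :
  continuous f -> continuous g -> continuous (fun x => f x * g x).
Proof. by move=> cf cg x; exact: cvgM (cf x) (cg x). Qed.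

Lemma continuous_funX (R : realType) (f : R -> R) n :
  continuous f -> continuous (fun x => f x ^+ n).
Proof.
move=> cf; elim: n => [|n IH]; first exact: continuous_fun_cst.
rewrite (_ : (fun _ => _) = fun x => f x * f x ^+ n); first exact: continuous_funM.
by apply/funext => x; rewrite exprS.
Qed.

Lemma continuous_fun_comp (R : realType) (f g : R -> R) :
  continuous f -> continuous g -> continuous (fun x => f (g x)).
Proof. by move=> cf cg x; exact: (continuous_comp (cg x) (cf (g x))). Qed.

Lemma continuous_fun_sum (R : realType) (F : nat -> R -> R) n :
  (forall k, continuous (F k)) -> continuous (fun x => \sum_(k < n) F k x).
Proof.
move=> cF; elim: n => [|n IH].
  rewrite (_ : (fun _ => _) = fun=> 0); first exact: continuous_fun_cst.
  by apply/funext => x; rewrite big_ord0.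
rewrite (_ : (fun _ => _) = fun x => \sum_(k < n) F k x + F n x).
  exact: continuous_funD.
by apply/funext => x; rewrite big_ord_recr.
Qed.

(** Works on the syntax of the function and leaves open the goals that it cannot close, such as
    [cosn n] and [sinn n]. *)
Ltac solve_continuous :=
  match goal with
  | H : continuous ?f |- continuous ?f => exact H
  | |- continuous (fun _ => ?c) => exact: continuous_fun_cst
  | |- continuous (fun z => z) => exact: continuous_fun_id
  | |- continuous (fun z => ?f z) => assumption
  | |- continuous (fun _ => _ + - _) =>
      apply: continuous_funB; solve_continuous
  | |- continuous (fun _ => _ + _) => apply: continuous_funD; solve_continuous
  | |- continuous (fun _ => - _) => apply: continuous_funN; solve_continuous
  | |- continuous (fun _ => _ * _) => apply: continuous_funM; solve_continuous
  | |- continuous (fun _ => _ ^+ _) => apply: continuous_funX; solve_continuous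
  | |- continuous (fun _ => cos _) =>
      apply: (continuous_fun_comp (@continuous_cos _)); solve_continuous
  | |- continuous (fun _ => sin _) =>
      apply: (continuous_fun_comp (@continuous_sin _)); solve_continuous
  | |- _ => idtac
  end.

Section int01.
Context {R : realType}.
Implicit Types f g : R -> R.

Lemma continuous_integrable01 g : continuous g -> integrable01 g.
Proof.
move=> cg; apply: continuous_compact_integrable; first exact: segment_compact.
exact: continuous_subspaceT.
Qed.

Lemma int01D f g : integrable01 f -> integrable01 g ->
  int01 (fun x => f x + g x) = int01 f + int01 g.
Proof. by move=> ? ?; rewrite /int01 RintegralD. Qed.

Lemma int01B f g : integrable01 f -> integrable01 g ->
  int01 (fun x => f x - g x) = int01 f - int01 g.
Proof. by move=> ? ?; rewrite /int01 RintegralB. Qed.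

Lemma int01Z c g : integrable01 g -> int01 (fun x => c * g x) = c * int01 g.
Proof. by move=> ?; rewrite /int01 RintegralZl. Qed.

Lemma int01_cst c : int01 (fun=> c : R) = c.
Proof.
rewrite /int01 Rintegral_cst//= lebesgue_measure_itv/= lte_fin ltr01.
by rewrite oppr0 adde0 mulr1.
Qed.

Lemma int01_ge0 g : (forall x, 0 <= g x) -> 0 <= int01 g.
Proof. by move=> g0; exact: Rintegral_ge0. Qed.

Lemma le_int01 f g : continuous f -> continuous g ->
  (forall x, f x <= g x) -> int01 f <= int01 g.
Proof. by move=> cf cg fg; apply: le_Rintegral => //; exact: continuous_integrable01. Qed.

Lemma normr_int01_le g M : continuous g -> (forall x, `|g x| <= M) ->
  `|int01 g| <= M.
Proof.
move=> cg gM; rewrite ler_norml -[M in - M]int01_cst -[X in _ && (_ <= X)]int01_cst.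
rewrite -mulN1r -int01Z; last exact/continuous_integrable01/continuous_fun_cst.
apply/andP; split; apply: le_int01; solve_continuous => x;
  have := gM x; rewrite ler_norml => /andP[]//.
by rewrite mulN1r.
Qed.

Lemma int01_derive (F f : R -> R) : (forall x : R, is_derive x 1 F (f x)) -> continuous f ->
  int01 f = F 1 - F 0.
Proof.
move=> dF cf; rewrite /int01 /Rintegral (@continuous_FTC2 _ f F)//.
- exact: continuous_subspaceT.
- have cF x : {for x, continuous F}.
    by apply: differentiable_continuous; apply/derivable1_diffP; case: (dF x).
  split.
  + by move=> x _; case: (dF x).
  + by apply: cvg_at_right_filter; exact: cF.
  + by apply: cvg_at_left_filter; exact: cF.
- by move=> x _; rewrite derive1E; case: (dF x).
Qed.

Lemma int01_derive_periodic (F f : R -> R) : (forall x : R, is_derive x 1 F (f x)) ->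
  continuous f -> periodic F 1 -> int01 f = 0.
Proof.
move=> dF cf pF; rewrite (int01_derive dF cf).
by have := pF 0; rewrite add0r => ->; rewrite subrr.
Qed.

Lemma int01_sum (F : nat -> R -> R) n : (forall k, continuous (F k)) ->
  int01 (fun x => \sum_(k < n) F k x) = \sum_(k < n) int01 (F k).
Proof.
move=> cF; elim: n => [|n IH].
  rewrite big_ord0 -[RHS]int01_cst; congr int01.
  by apply/funext => x; rewrite big_ord0.
rewrite big_ord_recr/= -IH -int01D; first last.
- exact: continuous_integrable01.
- exact/continuous_integrable01/continuous_fun_sum.
by congr int01; apply/funext => x; rewrite big_ord_recr.
Qed.

End int01.

Lemma periodicZ (R : realType) (g : R -> R) (k : int) x :
  periodic g 1 -> g (x + k%:~R) = g x.
Proof.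
move=> pg; have pn m y : g (y + m%:R) = g y.
  elim: m y => [|m IH] y; first by rewrite addr0.
  by rewrite -natr1 addrA pg.
case: k => m; first exact: pn.
by rewrite NegzE mulrNz -(pn m.+1) subrK.
Qed.

(** On centred representatives the cosine depends only on the absolute value and decreases with it,
    so its size measures the distance to the integers. *)
Lemma periodic_reduce (R : realType) (x : R) :
  exists k : int, - 2^-1 <= x - k%:~R <= 2^-1.
Proof.
exists (Num.floor (x + 2^-1)).
have := floor_le (x + 2^-1); have := lt_succ_floor (x + 2^-1).
by rewrite intrD; set k := (Num.floor _)%:~R; lra.
Qed.

Lemma int01_eq0 (R : realType) (g : R -> R) : continuous g -> periodic g 1 ->
  (forall x, 0 <= g x) -> int01 g = 0 -> forall x, g x = 0.
Proof.
move=> cg pg g0 ig.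
suff H x : x \in `]0, 1[ -> g x = 0.
  (* Neighbourhoods of 0 leave [[0, 1]], so the point 0 is reached by continuity from interior
     points. *)
  have H01 x : x \in `[0, 1[ -> g x = 0.
    rewrite in_itv/= => /andP[x0 x1]; have [->|xn0] := eqVneq x 0; last first.
      by apply: H; rewrite in_itv/= x1 lt_neqAle eq_sym xn0 x0.
    apply/eqP; rewrite eq_le g0 andbT leNgt; apply/negP => gp.
    have [e e0 He] : exists2 e : R, 0 < e & forall y, `|y| < e -> 0 < g y.
      have /cvgrPdist_lt/(_ _ gp) [e e0 He] := cg 0.
      exists e => // y ye; have := He y; rewrite /ball/= sub0r normrN => /(_ ye).
      by rewrite ltr_norml; lra.
    have := He (Num.min (e / 2) 2^-1); rewrite (H (Num.min (e / 2) 2^-1)).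
      rewrite ltxx => W; suff : false by []. apply: W.
      rewrite ger0_norm; last by rewrite le_min; lra.
      by rewrite gt_min; apply/orP; left; lra.
    by rewrite in_itv/= lt_min gt_min; apply/andP; split; [|apply/orP; right]; lra.
  move=> x; rewrite -(@periodicZ _ g (- Num.floor x) x)//; apply: H01.
  have := floor_le x; have := lt_succ_floor x; rewrite intrD in_itv/= mulrNz.
  by set k := (Num.floor _)%:~R; lra.
rewrite in_itv/= => /andP[x0 x1].
apply/eqP; rewrite eq_le g0 andbT leNgt; apply/negP => gp.
have [e e0 He] : exists2 e : R, 0 < e & forall y, `|x - y| < e -> g x / 2 <= g y.
  have gp2 : 0 < g x / 2 by lra.
  have /cvgrPdist_lt/(_ _ gp2) [e e0 He] := cg x.
  exists e => // y ye; have := He y; rewrite /ball/= => /(_ ye).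
  by rewrite ltr_norml; lra.
(* The half of [e] keeps the closed interval [[x, x + d]] inside the open neighbourhood, and [1 - x]
   keeps it inside the period. *)
pose d := Num.min (e / 2) (Num.min x (1 - x)).
have [d0 de dx d1] : [/\ 0 < d, d <= e / 2, d <= x & d <= 1 - x].
  by split; rewrite /d ?lt_min ?ge_min ?lexx ?orbT// -?ge_min; lra.
have sub : `[x, x + d] `<=` `[0, 1 : R].
  by move=> y /=; rewrite !in_itv/= => /andP[? ?]; lra.
have mg := measurable_int lebesgue_measure (continuous_integrable01 cg).
have : ((g x / 2 * d)%:E <= \int[@lebesgue_measure R]_(y in `[0%R, 1%R]) (g y)%:E)%E.
  apply: (@le_trans _ _ (\int[@lebesgue_measure R]_(y in `[x, (x + d)%R]) (g x / 2)%:E)%E).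
    rewrite integral_cst//= lebesgue_measure_itv/= lte_fin ltrDl d0.
    by rewrite -EFinD -EFinM lee_fin addrAC subrr add0r.
  apply: (@le_trans _ _ (\int[@lebesgue_measure R]_(y in `[x, (x + d)%R]) (g y)%:E)%E).
    apply: ge0_le_integral => //=.
    - by move=> y _; rewrite lee_fin; lra.
    - exact: (measurable_funS _ sub mg).
    - move=> y; rewrite in_itv/= => /andP[? ?]; rewrite lee_fin; apply: He.
      by rewrite ltr_norml; lra.
  by apply: ge0_subset_integral => //= y _; rewrite lee_fin.
rewrite -(fineK (integrable_fin_num _ (continuous_integrable01 cg)))//.
rewrite lee_fin -[fine _]/(int01 g) ig; apply/negP; rewrite -ltNge.
by apply: mulr_gt0 => //; lra.
Qed.

(** * Fourier coefficients determine a continuous function *)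

Section derivative_of_lambda.
Context {R : realType}.
Implicit Types (f g : R -> R) (x : R).

Lemma is_derive_funD f g x a b : is_derive x 1 f a -> is_derive x 1 g b ->
  is_derive x 1 (fun y => f y + g y) (a + b).
Proof. by move=> ? ?; exact: is_deriveD. Qed.

Lemma is_derive_funB f g x a b : is_derive x 1 f a -> is_derive x 1 g b ->
  is_derive x 1 (fun y => f y - g y) (a - b).
Proof. by move=> ? ?; exact: is_deriveB. Qed.

Lemma is_derive_funM f g x a b : is_derive x 1 f a -> is_derive x 1 g b ->
  is_derive x 1 (fun y => f y * g y) (a * g x + f x * b).
Proof.
move=> df dg; apply: is_derive_eq (is_deriveM df dg) _.
by rewrite /GRing.scale/= addrC [a * _]mulrC.
Qed.

Lemma is_derive_funZ f x a c : is_derive x 1 f a ->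
  is_derive x 1 (fun y => c * f y) (c * a).
Proof. by move=> df; exact: is_deriveZ. Qed.

Lemma is_derive_fun_comp f g x a b : is_derive (g x) 1 f a ->
  is_derive x 1 g b -> is_derive x 1 (fun y => f (g y)) (a * b).
Proof. by move=> df dg; exact: is_derive1_comp. Qed.

Lemma is_derive_fun_sum (F dF : nat -> R -> R) n x :
  (forall k, is_derive x 1 (F k) (dF k x)) ->
  is_derive x 1 (fun y => \sum_(k < n) F k y) (\sum_(k < n) dF k x).
Proof.
move=> dFx; elim: n => [|n IH].
  rewrite big_ord0 (_ : (fun _ => _) = cst 0); first exact: is_derive_cst.
  by apply/funext => y; rewrite big_ord0.
rewrite big_ord_recr/= (_ : (fun _ => _) = fun y => \sum_(k < n) F k y + F n y).
  exact: is_derive_funD.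
by apply/funext => y; rewrite big_ord_recr.
Qed.

Lemma is_derive_continuous f x a : is_derive x 1 f a -> {for x, continuous f}.
Proof.
by case=> df _; apply: differentiable_continuous; exact/derivable1_diffP.
Qed.

End derivative_of_lambda.

Definition cosn (R : realType) (n : nat) (x : R) : R := cos (2 * pi * n%:R * x).
Definition sinn (R : realType) (n : nat) (x : R) : R := sin (2 * pi * n%:R * x).

Section trigonometric_system.
Context {R : realType}.
Implicit Types (x : R) (n m : nat).

Lemma cosn0 x : cosn 0 x = 1.
Proof. by rewrite /cosn mulr0 mul0r cos0. Qed.

Lemma sinn0 x : sinn 0 x = 0.
Proof. by rewrite /sinn mulr0 mul0r sin0. Qed.

Lemma is_derive_cosn n x : is_derive x 1 (@cosn R n) (- (2 * pi * n%:R) * sinn n x).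
Proof.
have dl : is_derive x 1 (fun y : R => 2 * pi * n%:R * y) (2 * pi * n%:R * 1).
  by apply: is_derive_funZ; exact: is_derive_id.
by apply: is_derive_eq (is_derive_fun_comp (is_derive_cos _) dl) _; rewrite /sinn /=; ring.
Qed.

Lemma is_derive_sinn n x : is_derive x 1 (@sinn R n) (2 * pi * n%:R * cosn n x).
Proof.
have dl : is_derive x 1 (fun y : R => 2 * pi * n%:R * y) (2 * pi * n%:R * 1).
  by apply: is_derive_funZ; exact: is_derive_id.
by apply: is_derive_eq (is_derive_fun_comp (is_derive_sin _) dl) _; rewrite /cosn /=; ring.
Qed.

Lemma continuous_cosn n : continuous (@cosn R n).
Proof. by move=> x; exact: is_derive_continuous (is_derive_cosn n x). Qed.

Lemma continuous_sinn n : continuous (@sinn R n).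
Proof. by move=> x; exact: is_derive_continuous (is_derive_sinn n x). Qed.

Lemma periodic_cosn n : periodic (@cosn R n) 1.
Proof.
move=> x; rewrite /cosn -[RHS](periodicn (@cosD2pi R) n); congr cos.
ring.
Qed.

Lemma periodic_sinn n : periodic (@sinn R n) 1.
Proof.
move=> x; rewrite /sinn -[RHS](periodicn (@sinD2pi R) n); congr sin.
ring.
Qed.

Lemma normr_cosn_le1 n x : `|cosn n x| <= 1. Proof. exact: cos_max. Qed.
Lemma normr_sinn_le1 n x : `|sinn n x| <= 1. Proof. exact: sin_max. Qed.

Lemma cosnD n m x : cosn (n + m) x = cosn n x * cosn m x - sinn n x * sinn m x.
Proof. by rewrite /cosn /sinn -cosD; congr cos; rewrite natrD; ring. Qed.

Lemma sinnD n m x : sinn (n + m) x = sinn n x * cosn m x + cosn n x * sinn m x.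
Proof. by rewrite /cosn /sinn -sinD; congr sin; rewrite natrD; ring. Qed.

Lemma cosn2Dsinn2 n x : cosn n x ^+ 2 + sinn n x ^+ 2 = 1.
Proof. exact: cos2Dsin2. Qed.

Let two_pi_n_neq0 n : (0 < n)%N -> 2 * pi * n%:R != 0 :> R.
Proof.
by move=> n0; rewrite !mulf_neq0 ?pnatr_eq0 ?gt_eqF ?pi_gt0 //; case: n n0.
Qed.

Lemma int01_cosn n : int01 (@cosn R n) = (n == 0%N)%:R.
Proof.
case: n => [|n]; first by rewrite (_ : cosn 0 = fun=> 1) ?int01_cst//; apply/funext =>
  x; rewrite cosn0.
apply: (@int01_derive_periodic _ (fun x => (2 * pi * n.+1%:R)^-1 * sinn n.+1 x)).
- move=> x; apply: is_derive_eq (is_derive_funZ _ (is_derive_sinn _ _)) _.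
  by rewrite mulrA mulVf ?mul1r// two_pi_n_neq0.
- exact: continuous_cosn.
- by move=> x; rewrite periodic_sinn.
Qed.

Lemma int01_sinn n : int01 (@sinn R n) = 0.
Proof.
case: n => [|n]; first by rewrite (_ : sinn 0 = fun=> 0) ?int01_cst//; apply/funext =>
  x; rewrite sinn0.
apply: (@int01_derive_periodic _ (fun x => - (2 * pi * n.+1%:R)^-1 * cosn n.+1 x)).
- move=> x; apply: is_derive_eq (is_derive_funZ _ (is_derive_cosn _ _)) _.
  by rewrite mulrA mulrNN mulVf ?mul1r// two_pi_n_neq0.
- exact: continuous_sinn.
- by move=> x; rewrite periodic_cosn.
Qed.

End trigonometric_system.

Ltac solve_continuous_trig := solve_continuous;
  try (exact: continuous_cosn || exact: continuous_sinn).

Definition cos_coef (R : realType) (g : R -> R) (n : nat) : R :=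
  int01 (fun x => g x * cosn n x).
Definition sin_coef (R : realType) (g : R -> R) (n : nat) : R :=
  int01 (fun x => g x * sinn n x).

(** The larger index is written [n + d], so that the difference of the frequencies is [d] and no
    truncated subtraction occurs. *)
Lemma trig_mul_formulas (R : realType) n d (x : R) :
  [/\ cosn n x * cosn (n + d) x = 2^-1 * (cosn (n + (n + d)) x + cosn d x),
      sinn n x * sinn (n + d) x = 2^-1 * (cosn d x - cosn (n + (n + d)) x),
      cosn n x * sinn (n + d) x = 2^-1 * (sinn (n + (n + d)) x + sinn d x) &
      sinn n x * cosn (n + d) x = 2^-1 * (sinn (n + (n + d)) x - sinn d x)].
Proof.
have E : sinn n x ^+ 2 = 1 - cosn n x ^+ 2 by exact: sin2cos2.
by rewrite !(cosnD, sinnD); split; field: E.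
Qed.

(** The multiplicity of a frequency once n and -n are folded together: a real function is the sum of
    [wt n * (a n * cosn n + b n * sinn n)]. *)
Definition wt (R : realType) (n : nat) : R := if n is 0%N then 1 else 2.

Section fourier_uniqueness.
Context {R : realType}.
Implicit Types (g Q : R -> R) (x : R) (n m : nat).

(** The square of [cosn n] has mean 1 for [n = 0] and 1/2 otherwise, which [wt] compensates. *)
Lemma int01_cosn_mul n m :
  wt R n * int01 (fun x : R => cosn n x * cosn m x) = (n == m)%:R.
Proof.
wlog : n m / (n <= m)%N => [W|/subnKC <-].
  have [/W//|/ltnW mn] := leqP n m.
  have [->|nm] : n = m \/ n != m by case: eqVneq; [left|right].
    exact: W.
  have := W _ _ mn; rewrite eq_sym (negbTE nm) => /eqP; rewrite mulf_eq0.
  case/orP => [|/eqP Z]; first by case: (m) => [|?] /=; lra.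
  rewrite (_ : (fun _ => _) = fun x : R => cosn m x * cosn n x) ?Z ?mulr0//.
  by apply/funext => x; rewrite mulrC.
move: (m - n)%N => d.
rewrite (_ : (fun _ => _) = fun x : R => 2^-1 * (cosn (n + (n + d)) x + cosn d x)).
  rewrite int01Z ?int01D ?int01_cosn; try by apply: continuous_integrable01;
    solve_continuous_trig.
  case: d => [|d]; rewrite ?addn0 ?addnS ?eqxx/=.
    by case: n => [|n] /=; rewrite /= ?addnS/=; lra.
  by rewrite -[X in X == _]addn0 -addnS eqn_add2l/=; lra.
by apply/funext => x; case: (trig_mul_formulas n d x).
Qed.

Lemma int01_sinn_mul n m :
  wt R n * int01 (fun x : R => sinn n x * sinn m x) = ((n == m) && (n != 0%N))%:R.
Proof.
wlog : n m / (n <= m)%N => [W|/subnKC <-].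
  have [/W//|/ltnW mn] := leqP n m.
  have [->|nm] : n = m \/ n != m by case: eqVneq; [left|right].
    exact: W.
  have := W _ _ mn; rewrite eq_sym (negbTE nm) => /eqP; rewrite mulf_eq0.
  case/orP => [|/eqP Z]; first by case: (m) => [|?] /=; lra.
  rewrite (_ : (fun _ => _) = fun x : R => sinn m x * sinn n x) ?Z ?mulr0//.
  by apply/funext => x; rewrite mulrC.
move: (m - n)%N => d.
rewrite (_ : (fun _ => _) = fun x : R => 2^-1 * (cosn d x - cosn (n + (n + d)) x)).
  rewrite int01Z ?int01B ?int01_cosn; try by apply: continuous_integrable01;
    solve_continuous_trig.
  case: d => [|d]; rewrite ?addn0 ?addnS ?eqxx/=.
    by case: n => [|n] /=; rewrite /= ?addnS/=; lra.
  by rewrite -[X in X == _]addn0 -addnS eqn_add2l/=; lra.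
by apply/funext => x; case: (trig_mul_formulas n d x).
Qed.

Lemma int01_cosn_sinn n m : int01 (fun x : R => cosn n x * sinn m x) = 0.
Proof.
have [/subnKC <-|/ltnW/subnKC <-] := leqP n m.
  rewrite (_ : (fun _ => _) = fun x : R => 2^-1 * (sinn (n + (n + (m - n))) x + sinn (m
    - n) x)).
    rewrite int01Z ?int01D ?int01_sinn ?addr0 ?mulr0//; by apply:
      continuous_integrable01; solve_continuous_trig.
  by apply/funext => x; case: (trig_mul_formulas n (m - n) x).
rewrite (_ : (fun _ => _) = fun x : R => 2^-1 * (sinn (m + (m + (n - m))) x - sinn (n -
  m) x)).
  rewrite int01Z ?int01B ?int01_sinn ?subr0 ?mulr0//; by apply:
    continuous_integrable01; solve_continuous_trig.
by apply/funext => x; rewrite mulrC; case: (trig_mul_formulas m (n - m) x).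
Qed.

Let orth g (k : R -> R) := continuous k /\ int01 (fun x => g x * k x) = 0.

Let orthD g k l : continuous g -> orth g k -> orth g l -> orth g (fun x => k x + l x).
Proof.
move=> cg [ck k0] [cl l0]; split; first exact: continuous_funD.
rewrite (_ : (fun _ => _) = fun x => g x * k x + g x * l x).
  by rewrite int01D ?k0 ?l0 ?addr0//; apply: continuous_integrable01; solve_continuous.
by apply/funext => x; rewrite mulrDr.
Qed.

Let orthZ g k c : continuous g -> orth g k -> orth g (fun x => c * k x).
Proof.
move=> cg [ck k0]; split; first by solve_continuous.
rewrite (_ : (fun _ => _) = fun x => c * (g x * k x)).
  by rewrite int01Z ?k0 ?mulr0//; apply: continuous_integrable01; solve_continuous.
by apply/funext => x; rewrite mulrCA.
Qed.

Let flat g := continuous g /\ forall n, cos_coef g n = 0 /\ sin_coef g n = 0.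

(** Multiplication by [cosn 1] or [sinn 1] moves a frequency to its two neighbours, so each new
    coefficient is a linear combination of vanishing old ones. Iterating, [g] is orthogonal to every
    power of a trigonometric polynomial of degree 1. *)
Let flat_mul g c A B : flat g ->
  flat (fun x => g x * (c + A * cosn 1 x + B * sinn 1 x)).
Proof.
move=> [cg g0].
have oc n : orth g (cosn n) by split; [exact: continuous_cosn | case: (g0 n)].
have os n : orth g (sinn n) by split; [exact: continuous_sinn | case: (g0 n)].
split; first by solve_continuous_trig.
move=> n; split; rewrite /cos_coef /sin_coef.
  (* The product of [cosn n] with the degree 1 factor, expanded over frequencies [m] and [m + 2]
     around [n = m + 1]; frequency 0 has no lower neighbour. *)
  pose k n x : R := if n is m.+1 then
      c * cosn n x + A * (2^-1 * (cosn (m + 2) x + cosn m x))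
      + B * (2^-1 * (sinn (m + 2) x + (- 1) * sinn m x))
    else c * cosn n x + A * cosn 1 x + B * sinn 1 x.
  have [_ <-] : orth g (k n).
    by case: n => [|n]; rewrite /k; do ![apply: orthD | apply: orthZ | exact: oc |
      exact: os].
  congr int01; apply/funext => x; rewrite /k; case: n => [|n].
    by rewrite cosn0; ring.
  have [E1 _ _ E4] := trig_mul_formulas 1 n x.
  rewrite addn2; move: E1 E4; rewrite !add1n => E1 E4.
  rewrite mulN1r -E1 -E4; ring.
pose k n x : R := if n is m.+1 then
    c * sinn n x + A * (2^-1 * (sinn (m + 2) x + sinn m x))
    + B * (2^-1 * (cosn m x + (- 1) * cosn (m + 2) x))
  else 0 * cosn n x.
have [_ <-] : orth g (k n).
  by case: n => [|n]; rewrite /k; do ![apply: orthD | apply: orthZ | exact: oc | exact: os].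
congr int01; apply/funext => x; rewrite /k; case: n => [|n].
  by rewrite sinn0; ring.
have [_ E2 E3 _] := trig_mul_formulas 1 n x.
rewrite addn2; move: E2 E3; rewrite !add1n => E2 E3.
rewrite mulN1r -E2 -E3; ring.
Qed.

Lemma periodic_bounded g : continuous g -> periodic g 1 ->
  exists M, forall x, `|g x| <= M.
Proof.
move=> cg pg.
have cn : continuous (fun x => `|g x|) by move=> x; apply: cvg_norm; exact: cg.
have [c _ gc] := EVT_max (@ler01 R) (continuous_subspaceT cn).
exists `|g c| => x; rewrite -(@periodicZ _ g (- Num.floor x) x)//; apply: gc.
have := floor_le x; have := lt_succ_floor x; rewrite intrD in_itv/= mulrNz.
by set k := (Num.floor _)%:~R; lra.
Qed.

(** Linear growth in [n] already suffices for the concentration argument below. *)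
Let bernoulli (t : R) n : 0 <= t -> 1 + n%:R * t <= (1 + t) ^+ n.
Proof.
move=> t0; elim: n => [|n IH]; first by rewrite mul0r addr0 expr0.
rewrite exprS -natr1.
have : (1 + t) * (1 + n%:R * t) <= (1 + t) * (1 + t) ^+ n by apply: ler_wpM2l => //; lra.
apply: le_trans; have : 0 <= n%:R * t * t by rewrite !mulr_ge0.
lra.
Qed.

(* If g x0 > 0, the powers of a trigonometric polynomial that exceeds 1 only
   near x0 would concentrate there and have a positive integral against g. *)
Lemma fourier_uniqueness g : continuous g -> periodic g 1 ->
  (forall n, cos_coef g n = 0 /\ sin_coef g n = 0) -> forall x, g x = 0.
Proof.
suff H (h : R -> R) : continuous h -> periodic h 1 ->
    (forall n, cos_coef h n = 0 /\ sin_coef h n = 0) -> forall x, h x <= 0.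
  move=> cg pg g0 x; apply/eqP; rewrite eq_le H//= -oppr_le0 -mulN1r.
  apply: (H (fun x => -1 * g x)); [by solve_continuous|by move=> y; rewrite pg|].
  move=> n; have [c0 s0] := g0 n; rewrite /cos_coef /sin_coef.
  split; [rewrite -(mulr0 (-1)) -c0 -int01Z|rewrite -(mulr0 (-1)) -s0 -int01Z];
    try (by apply: continuous_integrable01; solve_continuous_trig);
    by congr int01; apply/funext => y; rewrite mulrA.
move=> ch ph h0 x0; rewrite leNgt; apply/negP => hp.
have [d [d0 d4 hd]] : exists d : R, [/\ 0 < d, d <= 4^-1 & forall y, `|y| < d -> h x0 /
  2 <= h (x0 + y)].
  have gp2 : 0 < h x0 / 2 by lra.
  have /cvgrPdist_lt/(_ _ gp2) [e e0 He] := ch x0.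
  exists (Num.min e 4^-1); split; [by rewrite lt_min e0 invr_gt0 ltr0n|by rewrite
    ge_min lexx orbT|].
  move=> y; rewrite lt_min => /andP[ye _]; have := He (x0 + y).
  by rewrite /ball/= opprD addrA subrr sub0r normrN => /(_ ye); rewrite ltr_norml; lra.
have pi0 := pi_gt0 R.
pose b := cos (2 * pi * d).
have ddom : 2 * pi * d \in `[0, pi] by rewrite in_itv/=; nra.
have b0 : 0 <= b by apply: cos_ge0_pihalf; nra.
have b1 : b < 1.
  rewrite -cos0 /b ltr_cos// ?in_itv/= ?lexx ?pi_ge0//; nra.
(* As [b] is the cosine at distance [d], [P] exceeds 1 exactly within distance [d] of [x0] modulo 1,
   where [h] is at least half of [h x0]. Elsewhere [P] lies between -1 and 1, so its powers stay
   bounded. *)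
pose P x := 1 - b + cos (2 * pi * x0) * cosn 1 x + sin (2 * pi * x0) * sinn 1 x.
have PE x : P x = 1 - b + cos (2 * pi * (x - x0)).
  by rewrite /P mulrBr cosB /cosn /sinn mulr1; ring.
have Pnear x : 1 < P x -> h x0 / 2 <= h x.
  rewrite PE => Pb; have [k ky] := periodic_reduce (x - x0).
  set y := _ - k%:~R in ky.
  have -> : h x = h (x0 + y).
    by rewrite -(periodicZ k (x0 + y) ph) /y; congr h; ring.
  apply: hd.
  have Ey : cos (2 * pi * (x - x0)) = cos (2 * pi * `|y|).
    have -> : 2 * pi * `|y| = `|2 * pi * y| :> R by rewrite normrM [`|2 *
      pi|]ger0_norm//; nra.
    rewrite cos_norm.
    have pc : periodic (fun z : R => cos (2 * pi * z)) 1.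
      by move=> z; have := @periodic_cosn R 1 z; rewrite /cosn mulr1.
    by rewrite -(periodicZ k y pc) /y subrK.
  have : b < cos (2 * pi * `|y|) by rewrite -Ey; lra.
  have ny : `|y| <= 2^-1 by rewrite ler_norml; lra.
  have ny0 := normr_ge0 y.
  rewrite /b ltr_cos ?ddom//; last by rewrite in_itv/=; nra.
  by rewrite ltr_pM2l// mulr_gt0.
have cP : continuous P by rewrite /P; solve_continuous_trig.
have hP0 k : int01 (fun x => h x * P x ^+ k) = 0.
  have [_ /(_ 0%N)[]] : flat (fun x => h x * P x ^+ k).
    elim: k => [|k IH].
      by rewrite (_ : (fun _ => _) = h); [split | apply/funext => x; rewrite expr0 mulr1].
    rewrite (_ : (fun _ => _) = fun x => h x * P x ^+ k * P x); first exact: flat_mul.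
    by apply/funext => x; rewrite exprSr mulrA.
  move=> <- _; congr int01; apply/funext => x.
  by rewrite cosn0 mulr1.
have [M hM] := periodic_bounded ch ph.
(* Twice the positive part of [P - 1], whence the 4 in the next bound. Where [P > 1], Bernoulli
   makes [h * P ^+ k] grow at least like [k * q]; elsewhere [q] is 0 and the product is at least
   [- M]. As all the integrals vanish, [k * int01 q] stays bounded in [k], so [q] is 0, although
   [q x0 > 0]. *)
pose q x := (P x - 1) + `|P x - 1|.
have cq : continuous q.
  have cP1 : continuous (fun x => P x - 1) by solve_continuous.
  by apply: (continuous_funD cP1) => x; apply: cvg_norm; exact: cP1.
have q0 x : 0 <= q x by rewrite /q; have := ler_norm (- (P x - 1)); rewrite normrN; lra.
have M0 : 0 <= M by exact: le_trans (normr_ge0 _) (hM 0).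
have key k x : h x0 / 4 * k%:R * q x - M <= h x * P x ^+ k.
  rewrite /q; have [Pl|Pg] := leP (P x - 1) 0.
    rewrite ler0_norm// subrr mulr0 sub0r; have : `|h x * P x ^+ k| <= M.
      rewrite normrM -[M]mulr1 normrX; apply: ler_pM => //; rewrite ?exprn_ge0//.
      rewrite exprn_ile1// ler_norml.
      have := cos_geN1 (2 * pi * (x - x0)); move: Pl; rewrite !PE; lra.
    by rewrite ler_norml => /andP[].
  rewrite gtr0_norm//; have := bernoulli k (ltW Pg); rewrite addrC [1 + (_ - 1)]addrC
    subrK => Pk.
  have hx := Pnear x; have {}hx : h x0 / 2 <= h x by apply: hx; lra.
  have : h x0 / 2 * P x ^+ k <= h x * P x ^+ k.
    by apply: ler_wpM2r => //; rewrite exprn_ge0//; lra.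
  apply: le_trans.
  have : h x0 / 2 * (k%:R * (P x - 1) + 1) <= h x0 / 2 * P x ^+ k by rewrite
    ler_pM2l//; lra.
  by apply: le_trans; lra.
have int_key k : h x0 / 4 * k%:R * int01 q <= M.
  rewrite -int01Z; last exact: continuous_integrable01.
  rewrite -subr_le0 -(hP0 k) -{1}[M](int01_cst M) -int01B.
  - by apply: le_int01; [solve_continuous|solve_continuous|exact: key].
  - by apply: continuous_integrable01; solve_continuous.
  - by apply: continuous_integrable01; solve_continuous.
have q_eq0 : int01 q = 0.
  apply/eqP; rewrite eq_le int01_ge0// andbT leNgt; apply/negP => q_gt0.
  have c_gt0 : 0 < h x0 / 4 * int01 q by apply: mulr_gt0; lra.
  have := archi_boundP (divr_ge0 M0 (ltW c_gt0)).
  rewrite ltr_pdivrMr// => /lt_le_trans/(_ (_ : _ <= M)).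
  by rewrite ltxx => W; suff : false by []; apply: W; apply: le_trans (int_key _);
    rewrite mulrC mulrAC.
have pq : periodic q 1.
  by move=> x; rewrite /q /P periodic_cosn periodic_sinn.
have := int01_eq0 cq pq q0 q_eq0 x0.
have Px : 0 < P x0 - 1 by rewrite PE subrr mulr0 cos0; lra.
by rewrite /q gtr0_norm//; lra.
Qed.

End fourier_uniqueness.

(** * Absolutely convergent trigonometric series *)

Section uniform_convergence.
Context {R : realType}.
Implicit Types (f g G H : R -> R) (F dF : nat -> R -> R) (x : R).

Lemma is_derive_epsP g x l : is_derive x 1 g l <->
  forall e : R, 0 < e -> exists2 d : R, 0 < d & forall h : R, h != 0 -> `|h| < d ->
    `|h^-1 * (g (x + h) - g x) - l| <= e.
Proof.
have E : (fun h : R => h^-1 *: (g (h *: 1 + x) - g x)) =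
         (fun h : R => h^-1 * (g (x + h) - g x)).
  by apply/funext => h; rewrite /GRing.scale/= mulr1 [h + x]addrC.
split=> [dg|P].
  have := @ex_derive _ _ _ _ _ _ _ dg; have <- := @derive_val _ _ _ _ _ _ _ dg.
  rewrite /derivable /derive !E => /cvgrPdist_le cv e e0.
  have [d d0 dP] := cv _ e0; exists d => // h hn0 hd.
  by rewrite distrC; apply: dP => //; rewrite /ball/= sub0r normrN.
have cv : h^-1 *: (g (h *: 1 + x) - g x) @[h --> 0^'] --> l.
  rewrite E; apply/cvgrPdist_le => e e0; have [d d0 dP] := P _ e0.
  exists d => // h /=; rewrite /ball/= sub0r normrN => hd hn0.
  by rewrite distrC; exact: dP.
by split; [apply/cvg_ex; exists l | exact: cvg_lim cv].
Qed.

Lemma mean_value_le f df a b K : a <= b ->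
  (forall x, is_derive x 1 f (df x)) ->
  (forall x, a <= x <= b -> `|df x| <= K) -> `|f b - f a| <= K * (b - a).
Proof.
move=> ab dfx dfK.
have cf : {within `[a, b], continuous f}.
  by apply: continuous_subspaceT => x; exact: is_derive_continuous (dfx x).
have [c] := MVT_segment ab (fun x _ => dfx x) cf.
rewrite in_itv/= => cab ->; rewrite normrM [`|b - a|]ger0_norm ?subr_ge0//.
by rewrite ler_wpM2r ?subr_ge0// dfK.
Qed.

Lemma mean_value_dist f df a b K :
  (forall x, is_derive x 1 f (df x)) ->
  (forall x, Num.min a b <= x <= Num.max a b -> `|df x| <= K) ->
  `|f a - f b| <= K * `|a - b|.
Proof.
move=> dfx; have [ab|/ltW ba] := leP a b => dfK.
  rewrite distrC [`|a - b|]distrC [`|b - a|]ger0_norm ?subr_ge0//.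
  exact: (mean_value_le ab dfx).
by rewrite [`|a - b|]ger0_norm ?subr_ge0//; exact: (mean_value_le ba dfx).
Qed.

Definition uniform_limit F G : Prop := forall e : R, 0 < e ->
  exists N, forall n, (N <= n)%N -> forall x, `|F n x - G x| <= e.

Lemma uniform_limit_continuous F G : (forall n, continuous (F n)) ->
  uniform_limit F G -> continuous G.
Proof.
move=> cF FG x; apply/cvgrPdist_le => e e0.
have e3 : 0 < e / 3 by lra.
have [N /(_ N (leqnn N)) NP] := FG _ e3.
have /cvgrPdist_le/(_ _ e3) [d d0 dP] := cF N x.
exists d => // y /dP.
have := NP x; have := NP y; rewrite /= !ler_norml.
set p := F N x; set q := F N y; lra.
Qed.

Lemma uniform_limit_int01 F G : (forall n, continuous (F n)) ->
  uniform_limit F G -> int01 (F n) @[n --> \oo] --> int01 G.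
Proof.
move=> cF FG; have cG := uniform_limit_continuous cF FG.
apply/cvgrPdist_le => e e0; have [N NP] := FG _ e0.
exists N => // n /= Nn; rewrite distrC -int01B; try exact: continuous_integrable01.
by apply: normr_int01_le; [exact: continuous_funB | exact: NP].
Qed.

Lemma uniform_limit_mul F G h M : (forall x, `|h x| <= M) ->
  uniform_limit F G -> uniform_limit (fun n x => h x * F n x) (fun x => h x * G x).
Proof.
move=> hM FG e e0.
have M0 : 0 <= M by exact: le_trans (normr_ge0 _) (hM 0).
(* [M] may be 0, hence the [+ 1]. *)
have [N NP] := FG (e / (M + 1)) (ltac:(apply: divr_gt0 => //; lra)).
exists N => n Nn x; rewrite -mulrBr normrM.
apply: le_trans (ler_pM _ _ (hM x) (NP n Nn x)) _ => //.
rewrite mulrA ler_pdivrMr; nra.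
Qed.

Lemma is_derive_uniform_limit F dF G H :
  (forall n x, is_derive x 1 (F n) (dF n x)) ->
  uniform_limit F G -> uniform_limit dF H -> forall x, is_derive x 1 G (H x).
Proof.
move=> dFx FG dFH x; apply/is_derive_epsP => e e0.
have e5 : 0 < e / 5 by lra.
have [N NP] := dFH _ e5.
have /is_derive_epsP/(_ _ e5)[d d0 dP] := dFx N x.
exists d => // h hn0 hd; have h_gt0 : 0 < `|h| by rewrite normr_gt0.
(* [G] is replaced by some [F m] with an error proportional to [|h|], so [m] depends on [h]; the
   mean value inequality for [F m - F N] gives two fifths and the replacement one. The quotient of
   [F N] and the distance from [dF N] to [H] use the other two. *)
have B : `|(G (x + h) - F N (x + h)) - (G x - F N x)| <= 3 * (e / 5) * `|h|.
  have eh : 0 < e / 5 * `|h| / 2 by nra.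
  have [N' N'P] := FG _ eh.
  pose m := maxn N N'.
  have /(N'P m) mP : (N' <= m)%N by rewrite leq_maxr.
  have dFm (y : R) : is_derive y 1 (fun z => F m z - F N z) (dF m y - dF N y).
    exact: is_derive_funB.
  have dFle y : `|dF m y - dF N y| <= 2 * (e / 5).
    have := NP m (leq_maxl _ _) y; have := NP N (leqnn _) y; rewrite !ler_norml; lra.
  have := mean_value_dist (a := x + h) (b := x) dFm (fun y _ => dFle y).
  have -> : x + h - x = h by ring.
  have := mP x; have := mP (x + h); rewrite !ler_norml.
  move: (F m (x + h)) (F N (x + h)) (F m x) (F N x) => p q r s; lra.
have := dP h hn0 hd; have := NP N (leqnn _) x.
set A := h^-1 * (F N (x + h) - F N x).
have -> : h^-1 * (G (x + h) - G x) = A + h^-1 * ((G (x + h) - F N (x + h)) - (G x - F N x)).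
  by rewrite /A; ring.
have : `|h^-1 * ((G (x + h) - F N (x + h)) - (G x - F N x))| <= 3 * (e / 5).
  by rewrite normrM normfV mulrC ler_pdivrMr.
rewrite !ler_norml; lra.
Qed.

End uniform_convergence.

Definition trig_sum (R : realType) (a b : nat -> R) (N : nat) (x : R) : R :=
  \sum_(k < N) wt R k * (a k * cosn k x + b k * sinn k x).

Definition abs_bounded (R : realType) (a b : nat -> R) (M : R) : Prop :=
  forall N, \sum_(k < N) (`|a k| + `|b k|) <= M.

Definition trig_series (R : realType) (a b : nat -> R) (x : R) : R :=
  limn (fun N => trig_sum a b N x).

Section trig_series.
Context {R : realType}.
Implicit Types (a b : nat -> R) (g : R -> R) (x M : R).

Lemma wt_bounds k : 0 < wt R k <= 2.
Proof. by case: k => [|k] /=; lra. Qed.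

Lemma trig_term_le a b k x :
  `|wt R k * (a k * cosn k x + b k * sinn k x)| <= 2 * (`|a k| + `|b k|).
Proof.
have := wt_bounds k => /andP[w0 w2]; rewrite normrM gtr0_norm//.
apply: ler_pM => //; first exact: ltW.
apply: le_trans (ler_normD _ _) _; rewrite !normrM; apply: lerD.
  by rewrite ler_piMr// normr_cosn_le1.
by rewrite ler_piMr// normr_sinn_le1.
Qed.

Lemma trig_sum_dist a b n m x : (n <= m)%N ->
  `|trig_sum a b m x - trig_sum a b n x| <=
  2 * (\sum_(k < m) (`|a k| + `|b k|) - \sum_(k < n) (`|a k| + `|b k|)).
Proof.
move=> /subnKC <-; elim: (m - n)%N => [|d IH]; first by rewrite addn0 !subrr normr0 mulr0.
rewrite addnS [trig_sum a b _.+1 x]big_ord_recr/= -/(trig_sum a b (n + d) x) big_ord_recr/=.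
rewrite addrAC; apply: le_trans (ler_normD _ _) _.
apply: le_trans (lerD IH (trig_term_le _ _ _ _)) _.
by rewrite -mulrDr addrAC.
Qed.

(** The partial sums are nondecreasing and bounded, hence convergent and Cauchy. *)
Lemma abs_bounded_tail a b M : abs_bounded a b M -> forall e : R, 0 < e ->
  exists N, forall n m, (N <= n <= m)%N ->
    \sum_(k < m) (`|a k| + `|b k|) - \sum_(k < n) (`|a k| + `|b k|) <= e.
Proof.
move=> ab e e0; pose S n := \sum_(k < n) (`|a k| + `|b k|).
have cS : cvgn S.
  apply: nondecreasing_is_cvgn; last by exists M => _ [n _ <-]; exact: ab.
  apply/nondecreasing_seqP => n; rewrite /S big_ord_recr/= lerDl.
  by rewrite addr_ge0.
have e2 : 0 < e / 2 by lra.
have /cvgrPdist_le/(_ _ e2)[N _ NP] := cS.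
exists N => n m /andP[Nn nm].
have := NP n Nn; have := NP m (leq_trans Nn nm).
rewrite -/(S m) -/(S n) !ler_norml; lra.
Qed.

(** The Weierstrass M-test: the tail estimate does not see [x], while the limit is identified
    pointwise at an index that may depend on [x]. *)
Lemma trig_series_uniform a b M : abs_bounded a b M ->
  uniform_limit (trig_sum a b) (trig_series a b).
Proof.
move=> ab.
have tailP e : 0 < e -> exists N, forall n m x, (N <= n <= m)%N ->
    `|trig_sum a b m x - trig_sum a b n x| <= e.
  move=> e0; have [N NP] := abs_bounded_tail ab (ltac:(lra) : 0 < e / 2).
  exists N => n m x /[dup] /NP H /andP[_ nm]; apply: le_trans (trig_sum_dist _ _ _ nm) _.
  lra.
have cv x : trig_sum a b n x @[n --> \oo] --> trig_series a b x.
  apply/cvg_ex; exists (trig_series a b x).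
  suff : cvgn (fun n => trig_sum a b n x) by [].
  apply: cauchy_cvg; apply/cauchy_exP => e e0.
  have [N NP] := tailP (e / 2) (ltac:(lra)).
  exists (trig_sum a b N x); exists N => // m /= Nm.
  rewrite /ball/= distrC; apply: le_lt_trans (NP N m x _) _; first by rewrite leqnn.
  lra.
move=> e e0; have [N NP] := tailP (e / 2) (ltac:(lra)).
exists N => n Nn x.
have /cvgrPdist_le/(_ _ (ltac:(lra) : 0 < e / 2))[N' _ N'P] := cv x.
have := N'P (maxn n N') (leq_maxr _ _).
have := NP n (maxn n N') x; rewrite Nn leq_maxl => /(_ isT).
rewrite !ler_norml; lra.
Qed.

Lemma continuous_trig_sum a b n : continuous (trig_sum a b n).
Proof.
apply: (continuous_fun_sum (F := fun k x => wt R k * (a k * cosn k x + b k * sinn k x))).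
by move=> k; solve_continuous_trig.
Qed.

Lemma continuous_trig_series a b M : abs_bounded a b M ->
  continuous (trig_series a b).
Proof.
by move=> /trig_series_uniform; apply: uniform_limit_continuous => n; exact:
  continuous_trig_sum.
Qed.

Lemma periodic_trig_series a b : periodic (trig_series a b) 1.
Proof.
move=> x; rewrite /trig_series; congr (lim (_ @ \oo)); apply/funext => n.
by apply: eq_bigr => k _; rewrite periodic_cosn periodic_sinn.
Qed.

Lemma normr_trig_series_le a b M x : abs_bounded a b M ->
  `|trig_series a b x| <= 2 * M.
Proof.
move=> ab; apply/ler_addgt0Pr => e e0.
have [N /(_ N (leqnn _) x)] := trig_series_uniform ab e0.
have := trig_sum_dist a b x (leq0n N); rewrite /trig_sum !big_ord0 !subr0.
have := ab N; rewrite !ler_norml; lra.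
Qed.

Lemma is_derive_trig_series a b M M' : abs_bounded a b M ->
  abs_bounded (fun k => 2 * pi * k%:R * b k) (fun k => - (2 * pi * k%:R * a k)) M' ->
  forall x, is_derive x 1 (trig_series a b)
    (trig_series (fun k => 2 * pi * k%:R * b k) (fun k => - (2 * pi * k%:R * a k)) x).
Proof.
move=> ab ab'; apply: is_derive_uniform_limit (trig_series_uniform ab)
  (trig_series_uniform ab').
move=> n x.
pose dT k (y : R) := wt R k * (2 * pi * k%:R * b k * cosn k y - 2 * pi * k%:R * a k *
  sinn k y).
have -> : trig_sum (fun k => 2 * pi * k%:R * b k) (fun k => - (2 * pi * k%:R * a k)) n
  x = \sum_(k < n) dT k x.
  by apply: eq_bigr => k _; rewrite /dT mulNr.
apply: (is_derive_fun_sum (F := fun k y => wt R k * (a k * cosn k y + b k * sinn k y))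
  (dF := dT)).
move=> k; apply: is_derive_eq (is_derive_funZ _ (is_derive_funD
  (is_derive_funZ _ (is_derive_cosn _ _)) (is_derive_funZ _ (is_derive_sinn _ _)))) _.
by rewrite /dT; ring.
Qed.

(** Uniform convergence permits termwise integration, and by orthogonality the integrals against
    mode [n] are stationary once the partial sum contains it. Since [sinn 0] is 0, the value [b 0]
    leaves no trace in the series. *)
Lemma coef_trig_series a b M n : abs_bounded a b M ->
  cos_coef (trig_series a b) n = a n /\
  sin_coef (trig_series a b) n = if n == 0%N then 0 else b n.
Proof.
move=> ab.
have coefP (k : R -> R) l : continuous k -> (forall x, `|k x| <= 1) ->
    (forall m, (n < m)%N -> int01 (fun x => k x * trig_sum a b m x) = l) ->
    int01 (fun x => trig_series a b x * k x) = l.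
  move=> ck k1 kl.
  have ckF m : continuous (fun x => k x * trig_sum a b m x).
    by apply: continuous_funM => //; exact: continuous_trig_sum.
  have /cvg_lim := uniform_limit_int01 ckF (uniform_limit_mul k1 (trig_series_uniform ab)).
  move=> /(_ (@Rhausdorff R)) E.
  rewrite (_ : (fun _ => _) = fun x => k x * trig_series a b x); last first.
    by apply/funext => x; rewrite mulrC.
  rewrite -E; apply: lim_near_cst => //; exists n.+1 => // m /= nm; exact: kl.
have sumP (k : R -> R) m : continuous k ->
    int01 (fun x => k x * trig_sum a b m x) =
    \sum_(i < m) (a i * (wt R i * int01 (fun x => cosn i x * k x))
                + b i * (wt R i * int01 (fun x => sinn i x * k x))).
  move=> ck.
  pose F i x := a i * (wt R i * (cosn i x * k x)) + b i * (wt R i * (sinn i x * k x)).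
  have -> : (fun x => k x * trig_sum a b m x) = fun x => \sum_(i < m) F i x.
    by apply/funext => x; rewrite mulr_sumr; apply: eq_bigr => i _; rewrite /F; ring.
  rewrite int01_sum; last by move=> i; rewrite /F; solve_continuous_trig.
  apply: eq_bigr => i _; rewrite /F int01D ?int01Z //; apply: continuous_integrable01;
    solve_continuous_trig.
split.
  apply: coefP; [exact: continuous_cosn|exact: normr_cosn_le1|] => m nm.
  rewrite sumP; last exact: continuous_cosn.
  rewrite (bigD1 (Ordinal nm))//= big1 ?addr0.
    rewrite int01_cosn_mul eqxx mulr1 (_ : (fun _ => _) = fun x => cosn n x * sinn n x)
      ?int01_cosn_sinn ?mulr0 ?addr0//.
    by apply/funext => x; rewrite mulrC.
  move=> i; rewrite -val_eqE/= => /negbTE ni.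
  rewrite int01_cosn_mul ni mulr0 (_ : (fun _ => _) = fun x => cosn n x * sinn i x)
    ?int01_cosn_sinn ?mulr0 ?addr0//.
  by apply/funext => x; rewrite mulrC.
apply: coefP; [exact: continuous_sinn|exact: normr_sinn_le1|] => m nm.
rewrite sumP; last exact: continuous_sinn.
rewrite (bigD1 (Ordinal nm))//= big1 ?addr0.
  rewrite int01_sinn_mul int01_cosn_sinn eqxx/= !mulr0 add0r.
  by case: eqVneq; rewrite ?mulr0 ?mulr1.
move=> i; rewrite -val_eqE/= => /negbTE ni.
by rewrite int01_sinn_mul ni int01_cosn_sinn !mulr0 addr0.
Qed.

(** The difference of the two sides is continuous, periodic and has only zero coefficients. *)
Lemma fourier_inversion g M : continuous g -> periodic g 1 ->
  abs_bounded (cos_coef g) (sin_coef g) M ->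
  g = trig_series (cos_coef g) (sin_coef g).
Proof.
move=> cg pg ab; apply/funext => x; apply/eqP; rewrite -subr_eq0; apply/eqP.
have ct := continuous_trig_series ab.
apply: (@fourier_uniqueness _ (fun y => g y - trig_series (cos_coef g) (sin_coef g) y)).
- by solve_continuous.
- by move=> y; rewrite pg periodic_trig_series.
move=> n; have [c s] := coef_trig_series n ab.
have subP (k : R -> R) : continuous k -> int01 (fun y => (g y - trig_series (cos_coef
  g) (sin_coef g) y) * k y) =
    int01 (fun y => g y * k y) - int01 (fun y => trig_series (cos_coef g) (sin_coef g)
      y * k y).
  move=> ck; rewrite -int01B; try by apply: continuous_integrable01; solve_continuous.
  by congr int01; apply/funext => y; rewrite mulrBl.
split; rewrite /cos_coef /sin_coef subP.
- by rewrite -/(cos_coef _ n) -[X in _ - X]/(cos_coef _ n) c subrr.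
- exact: continuous_cosn.
- rewrite -/(sin_coef _ n) -[X in _ - X]/(sin_coef _ n) s; case: eqP => [->|_]; rewrite
  ?subrr//.
  rewrite subr0 /sin_coef -[RHS](int01_cst 0); congr int01; apply/funext => y.
  by rewrite sinn0 mulr0.
- exact: continuous_sinn.
Qed.

End trig_series.

(** * Sobolev norms and Fourier coefficients *)

Section sobolev_sums.
Context {R : realType}.
Implicit Types (g k : R -> R) (s e : R) (n N : nat).

(** The bound [|g| <= 1 + g ^ 2] is integrable over one period. *)
Lemma integrable01_mul g k : L2_circle g -> continuous k ->
  (forall x, `|k x| <= 1) -> integrable01 (fun x => g x * k x).
Proof.
move=> [_ mg ig] ck k1.
have i1 : integrable01 (fun x => 1 + g x ^+ 2).
  rewrite /integrable01 (_ : EFin \o _ = (EFin \o cst 1) \+ (fun x => (g x ^+ 2)%:E))//.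
  have i0 : (@lebesgue_measure R).-integrable _ _ := continuous_integrable01
    (@continuous_fun_cst R 1).
  by apply: integrableD i0 ig.
rewrite /integrable01; apply: le_integrable i1 => //.
  apply/measurable_EFinP; apply: measurable_funM.
    exact: (measurable_funS _ (@subsetT _ _) mg).
  by apply: measurable_funTS; exact: continuous_measurable_fun.
move=> x _; rewrite /= lee_fin normrM.
apply: (@le_trans _ _ (`|g x| * 1)); first by rewrite ler_wpM2l.
rewrite mulr1 [`|1 + _|]ger0_norm; last by rewrite addr_ge0// sqr_ge0.
by rewrite -real_normK ?num_real//; nra.
Qed.

Lemma fourier_coefE g n :
  fourier g n%:Z = Complex (cos_coef g n) (- sin_coef g n).
Proof. by []. Qed.

(** Only finitely many nonnegative frequencies are kept from a sum of nonnegative terms; for real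
    [g] the negative ones repeat them. *)
Lemma sobolev_norm_sum_sqr s g c N : (sobolev_norm s g <= c%:E)%E ->
  \sum_(n < N) (1 + n%:R ^+ 2) `^ s * (cos_coef g n ^+ 2 + sin_coef g n ^+ 2)
    <= c ^+ 2.
Proof.
move=> gc; rewrite -lee_fin.
pose a (n : int) : \bar R :=
  ((1 + n%:~R ^+ 2) `^ s * ComplexField.Normc.normc (fourier g n) ^+ 2)%:E.
have a0 (m : int) : (0 <= a m)%E by rewrite lee_fin mulr_ge0 ?powR_ge0 ?exprn_even_ge0.
have S0 : (0 <= \esum_(n in [set: int]) a n)%E by apply: esum_ge0 => n _; exact: a0.
apply: (@le_trans _ _ (\esum_(n in [set: int]) a n)%E).
  apply: esum_ge; exists [set` map Posz (iota 0 N)].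
    by split; [exact: finite_seq|].
  rewrite -fsbig_seq; last by rewrite map_inj_uniq ?iota_uniq//; move=> ? ? [].
  rewrite big_map -[X in iota 0 X]subn0 -/(index_iota 0 N) big_mkord -sumEFin.
  apply: lee_sum => n _; rewrite /a lee_fin ler_wpM2l ?powR_ge0//.
  rewrite fourier_coefE /= sqr_sqrtr ?addr_ge0 ?sqr_ge0// sqrrN.
  exact: lexx.
have c0 : (0 <= c%:E)%E by apply: le_trans gc; exact: sqrte_ge0.
by rewrite -(sqr_sqrte S0) EFin_expe lee_sqr// sqrte_ge0.
Qed.

(* Dyadic blocks: 2 ^ j terms of size at most (4 ^ j) ^ (- e). *)
Lemma weight_sum_bounded e : 2^-1 < e -> exists2 Z, 0 <= Z &
  forall N, \sum_(n < N) (1 + n%:R ^+ 2) `^ (- e) <= Z :> R.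
Proof.
move=> e2; pose F n : R := (1 + n%:R ^+ 2) `^ (- e).
have F0 n : 0 <= F n by exact: powR_ge0.
(* The ratio of consecutive dyadic block bounds, below 1 because [e > 1/2]. *)
pose r : R := 2 / 4 `^ e.
have p4 : 2 < 4 `^ e :> R.
  have s4 : 4 `^ 2^-1 = 2 :> R.
    by rewrite powR12_sqrt// (_ : 4 = 2 ^+ 2) ?sqrtr_sqr ?ger0_norm//; ring.
  rewrite -(subrKC 2^-1 e) powRD ?pnatr_eq0 ?implybT// s4 ltr_pMr//.
  apply: (@le_lt_trans _ _ (1 `^ (e - 2^-1))); first by rewrite powR1.
  by apply: gt0_ltr_powR; rewrite ?nnegrE// ?subr_gt0// ltr1n.
have r0 : 0 < r by rewrite divr_gt0//; lra.
have r1 : r < 1 by rewrite ltr_pdivrMr; lra.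
have Fle j n : (2 ^ j <= n)%N -> F n <= (4 `^ e) ^- j.
  move=> jn; have w0 : 0 < 1 + n%:R ^+ 2 :> R by rewrite ltr_pwDl// exprn_ge0.
  have p40 : 0 < 4 `^ e :> R by rewrite powR_gt0.
  rewrite /F powRN lef_pV2 ?posrE ?exprn_gt0 ?powR_gt0//.
  rewrite -powR_mulrn ?powR_ge0// -powRrM mulrC powRrM powR_mulrn//.
  apply: ge0_ler_powR; [lra|by rewrite nnegrE exprn_ge0|by rewrite nnegrE ltW|].
  have : (2 ^ j)%:R <= n%:R :> R by rewrite ler_nat.
  rewrite natrX => jn'; have : 0 <= 2 ^+ j :> R by rewrite exprn_ge0.
  rewrite (_ : 4 = 2 * 2) ?exprMn; [|ring]; nra.
(* The summand 1 is the term [n = 0]; the indices from 2^j to 2^(j+1) - 1 contribute at most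
   [r ^+ j]. *)
have block J : \sum_(n < 2 ^ J) F n <= 1 + \sum_(j < J) r ^+ j.
  elim: J => [|J IH].
    rewrite expn0 big_ord_recr big_ord0 big_ord0/= add0r addr0 /F expr0n addr0.
    by rewrite powR1.
  rewrite expnS mul2n -addnn big_split_ord/= big_ord_recr/= addrA lerD//.
  apply: (@le_trans _ _ (\sum_(n < 2 ^ J) (4 `^ e) ^- J)).
    by apply: ler_sum => n _; apply: Fle; rewrite leq_addr.
  by rewrite sumr_const card_ord -[_ *+ _]mulr_natl natrX /r expr_div_n.
exists (1 + (1 - r)^-1); first by rewrite addr_ge0// invr_ge0; lra.
move=> N; have NN : (N <= 2 ^ N)%N by exact/ltnW/ltn_expl.
apply: (@le_trans _ _ (\sum_(n < 2 ^ N) F n)).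
  rewrite -!(big_mkord xpredT F) [leRHS](big_cat_nat _ _ (n := N))//=.
  by rewrite lerDl sumr_ge0.
apply: le_trans (block N) _; rewrite lerD2l.
rewrite -[(1 - r)^-1]mul1r ler_pdivlMr; last by lra.
have := subrX1 r N; rewrite -opprB => E.
have -> : (\sum_(i < N) r ^+ i) * (1 - r) = 1 - r ^+ N.
  by apply: (can_inj opprK); rewrite opprB subrX1; ring.
by rewrite lerBlDr lerDl exprn_ge0// ltW.
Qed.

(** Cauchy-Schwarz in the form 2XY <= X^2/c + cY^2, with X the term weighted by the power s/2 and Y
    the remaining weight, whose squares are summable. Taking the norm bound [c] as parameter makes
    the result linear in [c], so small norms give small sums. *)
Lemma sobolev_sum s (r : R) : 2^-1 < s - 2 * r -> exists2 K, 0 < K &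
  forall g (c : R), 0 < c -> (sobolev_norm s g <= c%:E)%E -> forall N,
    \sum_(n < N) (1 + n%:R ^+ 2) `^ r * (`|cos_coef g n| + `|sin_coef g n|)
      <= K * c.
Proof.
move=> sk; have [Z Z0 ZP] := weight_sum_bounded sk.
(* Twice the sum is at most [c] from the squares plus [2 * c * Z], the weights being counted once
   for cosines and once for sines. *)
exists (2^-1 + Z); first lra.
move=> g c c0 gc N; have SS := sobolev_norm_sum_sqr N gc.
have termP n (A : R) : 2 * ((1 + n%:R ^+ 2) `^ r * `|A|) <=
    c^-1 * ((1 + n%:R ^+ 2) `^ s * A ^+ 2) + c * (1 + n%:R ^+ 2) `^ (- (s - 2 * r)).
  set w : R := 1 + n%:R ^+ 2.
  have w0 : 0 < w by rewrite ltr_pwDl// sqr_ge0.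
  have pD (x y : R) : w `^ (x + y) = w `^ x * w `^ y by rewrite powRD// (gt_eqF w0) implybT.
  pose X := w `^ (s / 2) * `|A|; pose Y := w `^ (r - s / 2).
  have -> : w `^ r * `|A| = X * Y.
    by rewrite /X /Y mulrAC -pD; congr (_ `^ _ * _); field.
  have -> : w `^ s * A ^+ 2 = X ^+ 2.
    by rewrite /X exprMn real_normK ?num_real// [(_ `^ _) ^+ 2]expr2 -pD; congr (_ `^ _
      * _); field.
  have -> : w `^ (- (s - 2 * r)) = Y ^+ 2.
    by rewrite /Y expr2 -pD; congr (_ `^ _); field.
  have : 0 <= c^-1 * (X - c * Y) ^+ 2 by rewrite mulr_ge0 ?sqr_ge0// invr_ge0 ltW.
  have -> : c^-1 * (X - c * Y) ^+ 2 = c^-1 * X ^+ 2 - 2 * (X * Y) + c * Y ^+ 2.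
    by field; rewrite gt_eqF.
  lra.
have : 2 * \sum_(n < N) (1 + n%:R ^+ 2) `^ r * (`|cos_coef g n| + `|sin_coef g n|) <=
  c^-1 * (\sum_(n < N) (1 + n%:R ^+ 2) `^ s * (cos_coef g n ^+ 2 + sin_coef g n ^+ 2))
   + 2 * c * \sum_(n < N) (1 + n%:R ^+ 2) `^ (- (s - 2 * r)).
  rewrite !mulr_sumr -big_split/=; apply: ler_sum => n _.
  have := termP n (cos_coef g n); have := termP n (sin_coef g n).
  set w := 1 + _; lra.
have : c^-1 * (\sum_(n < N) (1 + n%:R ^+ 2) `^ s * (cos_coef g n ^+ 2 + sin_coef g n ^+
  2)) <= c.
  by rewrite mulrC ler_pdivrMr// -expr2.
have : c * \sum_(n < N) (1 + n%:R ^+ 2) `^ (- (s - 2 * r)) <= c * Z by rewrite ler_pM2l.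
lra.
Qed.

End sobolev_sums.

(** * Boundary uniqueness for power series *)

Definition expi (R : realType) (x : R) : R[i] := Complex (cosn 1 x) (sinn 1 x).

Section boundary_uniqueness.
Context {R : realType}.
Implicit Types (x y : R) (c : nat -> R[i]) (F : R -> R[i]).

Lemma expiD x y : expi (x + y) = expi x * expi y.
Proof.
rewrite /expi /cosn /sinn !mulrDr cosD sinD.
by apply/eqP; rewrite eq_complex /=; apply/andP; split; apply/eqP; ring.
Qed.

Lemma expi0 : expi (0 : R) = 1.
Proof. by rewrite /expi /cosn /sinn mulr0 cos0 sin0. Qed.

Lemma expi1 : expi (1 : R) = 1.
Proof.
have := @periodic_cosn R 1 0; have := @periodic_sinn R 1 0.
by rewrite add0r /expi => -> ->; rewrite -expi0.
Qed.

Lemma expi_natmul n x : expi (n%:R * x) = expi x ^+ n.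
Proof.
elim: n => [|n IH]; first by rewrite mul0r expi0 expr0.
by rewrite -natr1 mulrDl mul1r expiD IH exprSr.
Qed.

Lemma expiX n x : expi x ^+ n = Complex (cosn n x) (sinn n x).
Proof.
rewrite -expi_natmul /expi /cosn /sinn mulr1.
by congr Complex; congr (_ _); ring.
Qed.

Lemma norm_expi x : `|expi x| = 1.
Proof. by rewrite normc_def /= cosn2Dsinn2 sqrtr1. Qed.

Lemma expi_neq1 x : 0 < x < 1 -> expi x != 1.
Proof.
move=> /andP[x0 x1]; apply/negP => /eqP [c1 _].
have pi0 := pi_gt0 R.
(* Half angle: cos (2 pi x) = 1 - 2 sin (pi x)^2, which is 1 only if the sine vanishes. *)
have : sin (pi * x) != 0 by rewrite gt_eqF// sin_gt0_pi// mulr_gt0//= gtr_pMr.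
rewrite -sqrf_eq0 sin2cos2 => /negP; apply; apply/eqP.
move: c1; rewrite /cosn mulr1 (_ : 2 * pi * x = (pi * x) *+ 2); last by ring.
rewrite cos_mulr2n; lra.
Qed.

(** A discrete mean value property, exact for degree below [K]: the powers of a root of unity other
    than 1 form a geometric sum equal to 0. *)
Lemma mean_roots_of_unity (p : {poly R[i]}) K : (size p <= K)%N -> (0 < K)%N ->
  \sum_(k < K) p.[expi (k%:R / K%:R)] = p.[0] *+ K.
Proof.
move=> pK K0.
have rootP i : (i < K)%N -> \sum_(k < K) expi (k%:R / K%:R) ^+ i = (K * (i == 0))%:R :>
  R[i].
  case: i => [|i] iK.
    by rewrite muln1 -[in RHS](card_ord K) -sumr_const; apply: eq_bigr => k _; rewrite
      expr0.
  rewrite muln0; have KR0 : K%:R != 0 :> R by rewrite pnatr_eq0 -lt0n.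
  pose z : R[i] := expi (i.+1%:R / K%:R).
  have z1 : z != 1.
    by apply: expi_neq1; rewrite divr_gt0 ?ltr0n// ltr_pdivrMr ?ltr0n// mul1r ltr_nat.
  have -> : \sum_(k < K) expi (k%:R / K%:R) ^+ i.+1 = \sum_(k < K) z ^+ k.
    by apply: eq_bigr => k _; rewrite /z -!expi_natmul; congr expi; ring.
  have zK : z ^+ K = 1.
    rewrite /z -expi_natmul mulrCA divff// mulr1 -[i.+1%:R]mulr1 expi_natmul expi1.
    by rewrite expr1n.
  have := subrX1 z K; rewrite zK subrr => /esym/eqP.
  by rewrite mulf_eq0 subr_eq0 (negbTE z1) => /eqP.
under eq_bigr do rewrite (horner_coef_wide _ pK).
rewrite exchange_big horner_coef0.
rewrite (eq_bigr (fun i : 'I_K => p`_i * (K * (i == 0%N :> nat))%:R)); last first.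
  by move=> i _; rewrite -rootP// mulr_sumr.
rewrite (bigD1 (Ordinal K0))// big1.
  by rewrite /= muln1 mulr_natr addr0.
by move=> i; rewrite -val_eqE => /negbTE /= ->; rewrite muln0 mulr0.
Qed.

Let series_sum c n x : R[i] := \sum_(k < n) c k * expi x ^+ k.

Let series_sumE c n x : series_sum c n x = (\poly_(k < n) c k).[expi x].
Proof. by rewrite horner_poly. Qed.

Let norm_series_sum c B n x : \sum_(k < n) `|c k| <= B -> `|series_sum c n x| <= B.
Proof.
apply: le_trans; apply: le_trans (ler_norm_sum _ _ _) _.
by apply: ler_sum => k _; rewrite normrM normrX norm_expi expr1n mulr1.
Qed.

Let periodic_series_sum c n x (k : int) :
  series_sum c n (x + k%:~R) = series_sum c n x.
Proof.
have pE : periodic (@expi R) 1 by move=> y; rewrite expiD expi1 mulr1.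
apply: eq_bigr => j _; congr (_ * _ ^+ _).
by rewrite /expi !periodicZ//; [exact: periodic_sinn|exact: periodic_cosn].
Qed.

(* The rotations of the arc by multiples of 1/m cover the circle, so the product
   of the rotated sums is small everywhere; its mean is (c 0) ^ m. *)
Let constant_coef_eq0 c (B p q : R) : p < q ->
  (forall n, \sum_(k < n) `|c k| <= (B%:C)%C) ->
  (forall e : R, 0 < e -> exists N, forall n, (N <= n)%N ->
     forall x, p < x < q -> `|series_sum c n x| <= (e%:C)%C) ->
  c 0%N = 0.
Proof.
move=> pq cB small.
(* The rotation step 1/m must be shorter than the arc for the rotated arcs to cover the circle. *)
have [m m0 mpq] : exists2 m, (0 < m)%N & m%:R^-1 < q - p.
  have qp0 : 0 < (q - p)^-1 by rewrite invr_gt0 subr_gt0.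
  exists (Num.bound (q - p)^-1); have := archi_boundP (ltW qp0).
    by move/(lt_trans qp0); rewrite ltr0n.
  move=> h; rewrite invf_plt ?posrE ?subr_gt0//; exact: lt_trans h.
have mR0 : 0 < m%:R :> R by rewrite ltr0n.
have cover x : exists (j : 'I_m) (k : int), p < x + j%:R / m%:R + k%:~R < q.
  (* The least integer such that [x + l / m] lies beyond [p]; since the step is shorter than the
     arc, it also lies before [q]. Euclidean division of [l] by [m] separates the rotation index
     from the full turns. *)
  pose l : int := Num.floor (m%:R * (p - x)) + 1.
  have l1 : m%:R * (p - x) < l%:~R by have := lt_succ_floor (m%:R * (p - x)).
  have l2 : l%:~R <= m%:R * (p - x) + 1 by rewrite intrD lerD2r floor_le.
  have lm : (l %% m)%Z = `|(l %% m)%Z|%N :> int by rewrite gez0_abs// modz_ge0//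
    eqz_nat -lt0n.
  have jm : (`|(l %% m)%Z| < m)%N by rewrite -ltz_nat -lm ltz_mod// eqz_nat -lt0n.
  exists (Ordinal jm), (l %/ m)%Z => /=.
  have -> : x + `|(l %% m)%Z|%N%:R / m%:R + ((l %/ m)%Z)%:~R = x + l%:~R / m%:R.
    have -> : l%:~R = ((l %/ m)%Z)%:~R * m%:R + `|(l %% m)%Z|%N%:R :> R.
      by rewrite {1}(divz_eq l m) intrD intrM {1}lm.
    by field; exact: lt0r_neq0.
  rewrite -ltrBlDl ltr_pdivlMr// mulrC l1/=.
  rewrite -ltrBrDl ltr_pdivrMr//; apply: le_lt_trans l2 _.
  move: mpq; rewrite -[m%:R^-1]mul1r ltr_pdivrMr//; lra.
have B0 : 0 <= B by have := cB 0%N; rewrite big_ord0 lecR.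
(* At each point one factor is at most [e] and the other [m - 1] are at most [B]; this bounds the
   mean over the roots of unity, which is the value of the product at 0. *)
have main (e : R) : 0 < e -> `|c 0%N| ^+ m <= ((e * B ^+ m.-1)%:C)%C.
  move=> e0; have [N NP] := small e e0.
  pose n := N.+1.
  pose P : {poly R[i]} := \prod_(j < m) ((\poly_(k < n) c k) \Po (expi (j%:R / m%:R) *:
    'X)).
  have PE x : P.[expi x] = \prod_(j < m) series_sum c n (x + j%:R / m%:R).
    rewrite horner_prod; apply: eq_bigr => j _.
    by rewrite horner_comp hornerZ hornerX series_sumE expiD mulrC.
  have P0 : P.[0] = c 0%N ^+ m.
    rewrite horner_prod -[in RHS](card_ord m) -prodr_const; apply: eq_bigr => j _.
    by rewrite horner_comp hornerZ hornerX mulr0 horner_coef0 coef_poly.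
  have Ple x : `|P.[expi x]| <= ((e * B ^+ m.-1)%:C)%C.
    have [j [k jk]] := cover x.
    rewrite PE (bigD1 j)//= normrM rmorphM/=; apply: ler_pM => //.
      by rewrite -(periodic_series_sum _ _ _ k); apply: NP.
    rewrite normr_prod rmorphXn/=.
    have -> : m.-1 = #|predC1 j| by rewrite cardC1 card_ord.
    rewrite -prodr_const; apply: ler_prod => i _.
    by rewrite normr_ge0 norm_series_sum.
  pose K := (size P).+1.
  have KC : 0 < K%:R :> R[i] by rewrite ltr0n.
  rewrite -normrX -P0 -(ler_pM2r KC) mulr_natr -normrMn -(mean_roots_of_unity (leqnSn _))//.
  apply: le_trans (ler_norm_sum _ _ _) _.
  rewrite -[K in X in _ <= X]card_ord mulr_natr -sumr_const; apply: ler_sum => k _;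
    exact: Ple.
apply/eqP; rewrite -normr_eq0 normc_def; set r := Num.sqrt _.
have r0 : 0 <= r by rewrite sqrtr_ge0.
apply/negPn/negP => rn0.
have r_gt0 : 0 < r ^+ m.
  rewrite exprn_gt0// lt_neqAle r0 andbT eq_sym.
  by apply: contraNneq rn0 => ->.
have BB : 0 <= B ^+ m.-1 by rewrite exprn_ge0.
(* This tolerance makes the bound at most half of [r ^+ m], a contradiction; the [+ 1] covers a
   vanishing power of [B]. *)
have e0 : 0 < r ^+ m / 2 / (B ^+ m.-1 + 1) by rewrite !divr_gt0//; lra.
have := main _ e0; rewrite normc_def -/r -rmorphXn/= lecR mulrAC ler_pdivlMr; last by lra.
nra.
Qed.

(** Once [c 0 = 0], the sum is [expi x] times the sum of the shifted coefficients, and [expi x] has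
    modulus 1, so the shifted sequence satisfies the same hypotheses. Hence the induction on [n] for
    all sequences. *)
Lemma power_series_arc_eq0 c (B p q : R) : p < q ->
  (forall n, \sum_(k < n) `|c k| <= (B%:C)%C) ->
  (forall e : R, 0 < e -> exists N, forall n, (N <= n)%N ->
     forall x, p < x < q -> `|\sum_(k < n) c k * expi x ^+ k| <= (e%:C)%C) ->
  forall n, c n = 0.
Proof.
move=> pq cB small n; elim: n c cB small => [|n IH] c cB small.
  exact: (constant_coef_eq0 pq cB small).
have c0 := constant_coef_eq0 pq cB small.
apply: (IH (fun k => c k.+1)).
  by move=> k; have := cB k.+1; rewrite big_ord_recl c0 normr0 add0r.
move=> e e0; have [N NP] := small e e0; exists N => k Nk x xpq.
have := NP k.+1 (leqW Nk) x xpq; rewrite big_ord_recl c0 mul0r add0r.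
rewrite (eq_bigr (fun i : 'I_k => expi x * (c i.+1 * expi x ^+ i))).
  by rewrite -mulr_sumr normrM norm_expi mul1r.
by move=> i _; rewrite /= exprS mulrCA.
Qed.

End boundary_uniqueness.

(** * Fourier series of twice differentiable functions *)

(** Linearity of the coefficients is needed both for continuous functions and for the time
    derivative, known only as an L^2 function; this covers both. *)
Definition fourier_integrable (R : realType) (g : R -> R) : Prop :=
  forall n, integrable01 (fun x => g x * cosn n x) /\
            integrable01 (fun x => g x * sinn n x).

(** Absolute convergence that survives two derivatives: the form in which H^s with s > 5/2 yields
    regularity in space. *)
Definition weighted_bounded (R : realType) (g : R -> R) (M : R) : Prop :=
  forall N, \sum_(n < N) (1 + n%:R ^+ 2) * (`|cos_coef g n| + `|sin_coef g n|) <= M.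

Section periodic_C2.
Context {R : realType}.
Implicit Types (f g h : R -> R) (x M : R) (n : nat).

Lemma continuous_fourier_integrable g : continuous g -> fourier_integrable g.
Proof. by move=> cg n; split; apply: continuous_integrable01; solve_continuous_trig. Qed.

Lemma L2_fourier_integrable g : L2_circle g -> fourier_integrable g.
Proof.
move=> Lg n; split; apply: integrable01_mul => //.
- exact: continuous_cosn.
- exact: normr_cosn_le1.
- exact: continuous_sinn.
- exact: normr_sinn_le1.
Qed.

Lemma coefB f g n : fourier_integrable f -> fourier_integrable g ->
  cos_coef (fun x => f x - g x) n = cos_coef f n - cos_coef g n /\
  sin_coef (fun x => f x - g x) n = sin_coef f n - sin_coef g n.
Proof.
move=> /(_ n)[cf sf] /(_ n)[cg sg]; rewrite /cos_coef /sin_coef -!int01B//.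
by split; congr int01; apply/funext => x; rewrite mulrBl.
Qed.

Lemma sin_coef0 g : sin_coef g 0 = 0.
Proof.
rewrite /sin_coef -[RHS](int01_cst 0); congr int01.
by apply/funext => x; rewrite sinn0 mulr0.
Qed.

Lemma is_derive_derive1 g (dg : R -> R) : (forall x, is_derive x 1 g (dg x)) ->
  g^`()%classic = dg.
Proof. by move=> dgx; apply/funext => x; rewrite derive1E; case: (dgx x). Qed.

Lemma weighted_boundedB f g M N : fourier_integrable f -> fourier_integrable g ->
  weighted_bounded f M -> weighted_bounded g N -> weighted_bounded (fun x => f x - g x)
    (M + N).
Proof.
move=> If Ig fM gN n; apply: le_trans (lerD (fM n) (gN n)).
rewrite -big_split; apply: ler_sum => k _ /=.
have [-> ->] := coefB k If Ig; rewrite -mulrDr ler_wpM2l ?addr_ge0 ?exprn_ge0//.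
have := ler_normB (cos_coef f k) (cos_coef g k).
have := ler_normB (sin_coef f k) (sin_coef g k); lra.
Qed.

Section regularity.
Context (g : R -> R) (M : R).
Context (cg : continuous g) (pg : periodic g 1) (gM : weighted_bounded g M).

Lemma abs_bounded_weight (a b : nat -> R) (C : R) : 0 <= C ->
  (forall n, `|a n| + `|b n| <= C * ((1 + n%:R ^+ 2) * (`|cos_coef g n| + `|sin_coef g
    n|))) ->
  abs_bounded a b (C * M).
Proof.
move=> C0 abC N; apply: (@le_trans _ _ (\sum_(k < N)
  C * ((1 + k%:R ^+ 2) * (`|cos_coef g k| + `|sin_coef g k|)))).
  by apply: ler_sum => k _; exact: abC.
by rewrite -mulr_sumr ler_wpM2l.
Qed.

Let abs_bounded0 : abs_bounded (cos_coef g) (sin_coef g) M.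
Proof.
rewrite -[M]mul1r; apply: abs_bounded_weight => // n.
by rewrite mul1r ler_peMl ?addr_ge0// lerDl exprn_ge0.
Qed.

Let abs_bounded1 : abs_bounded (fun n => 2 * pi * n%:R * sin_coef g n)
  (fun n => - (2 * pi * n%:R * cos_coef g n)) (2 * pi * M).
Proof.
have pi0 := pi_ge0 R; apply: abs_bounded_weight => [|n]; first by rewrite mulr_ge0.
rewrite normrN !normrM [`|2|]ger0_norm// [`|pi|]ger0_norm// [`|n%:R|]ger0_norm//.
have : 0 <= `|cos_coef g n| + `|sin_coef g n| by rewrite addr_ge0.
rewrite -mulrDr addrC; set X := _ + _ => X0.
rewrite (_ : 2 * pi * n%:R * X = 2 * pi * (n%:R * X)); last by ring.
rewrite ler_wpM2l ?mulr_ge0// ler_wpM2r//.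
have : 0 <= (n%:R - 1) ^+ 2 :> R by exact: sqr_ge0.
nra.
Qed.

Let abs_bounded2 : abs_bounded (fun n => 2 * pi * n%:R * - (2 * pi * n%:R * cos_coef g n))
  (fun n => - (2 * pi * n%:R * (2 * pi * n%:R * sin_coef g n))) ((2 * pi) ^+ 2 * M).
Proof.
have pi0 := pi_ge0 R; apply: abs_bounded_weight => [|n]; first by rewrite sqr_ge0.
rewrite mulrN !normrN !normrM [`|2|]ger0_norm// [`|pi|]ger0_norm// [`|n%:R|]ger0_norm//.
have : 0 <= `|cos_coef g n| + `|sin_coef g n| by rewrite addr_ge0.
set X := _ + _ => X0.
have -> : 2 * pi * n%:R * (2 * pi * n%:R * `|cos_coef g n|) +
    2 * pi * n%:R * (2 * pi * n%:R * `|sin_coef g n|) = (2 * pi) ^+ 2 * (n%:R ^+ 2 * X).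
  by rewrite /X; ring.
by rewrite ler_wpM2l ?sqr_ge0// ler_wpM2r// lerDr.
Qed.

Let gE : g = trig_series (cos_coef g) (sin_coef g).
Proof. exact: fourier_inversion abs_bounded0. Qed.

Let dg x : is_derive x 1 g (trig_series (fun n => 2 * pi * n%:R * sin_coef g n)
  (fun n => - (2 * pi * n%:R * cos_coef g n)) x).
Proof. rewrite {1}gE; exact: is_derive_trig_series abs_bounded0 abs_bounded1 x. Qed.

Let ddg x := is_derive_trig_series abs_bounded1 abs_bounded2 x.

Let g1E := is_derive_derive1 dg.
Let g2E : (g^`(2))%classic =
  trig_series (fun n => 2 * pi * n%:R * - (2 * pi * n%:R * cos_coef g n))
    (fun n => - (2 * pi * n%:R * (2 * pi * n%:R * sin_coef g n))).
Proof. by rewrite /= g1E; exact: is_derive_derive1 ddg. Qed.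

Lemma is_derive_C2 x :
  is_derive x 1 g ((g^`())%classic x) /\ is_derive x 1 (g^`())%classic ((g^`(2))%classic x).
Proof. by rewrite g2E g1E; split; [exact: dg|exact: ddg]. Qed.

Lemma continuous_C2 : continuous (g^`())%classic /\ continuous (g^`(2))%classic.
Proof.
rewrite g2E g1E; split; first exact: continuous_trig_series abs_bounded1.
exact: continuous_trig_series abs_bounded2.
Qed.

Lemma C1_bounds x : `|g x| <= 2 * M /\ `|(g^`())%classic x| <= 2 * (2 * pi * M).
Proof.
rewrite g1E {1}gE; split; first exact: normr_trig_series_le abs_bounded0.
exact: normr_trig_series_le abs_bounded1.
Qed.

Lemma trig_sum_limit_C2 : uniform_limit (trig_sum (cos_coef g) (sin_coef g)) g.
Proof. rewrite {3}gE; exact: trig_series_uniform abs_bounded0. Qed.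

Lemma trig_sum_limit_derive2 : uniform_limit
  (trig_sum (fun n => - ((2 * pi * n%:R) ^+ 2 * cos_coef g n))
            (fun n => - ((2 * pi * n%:R) ^+ 2 * sin_coef g n))) (g^`(2))%classic.
Proof.
rewrite g2E; have := trig_series_uniform abs_bounded2.
suff -> : trig_sum (fun n => 2 * pi * n%:R * - (2 * pi * n%:R * cos_coef g n))
  (fun n => - (2 * pi * n%:R * (2 * pi * n%:R * sin_coef g n))) =
  trig_sum (fun n => - ((2 * pi * n%:R) ^+ 2 * cos_coef g n))
            (fun n => - ((2 * pi * n%:R) ^+ 2 * sin_coef g n)) by [].
by apply/funext => N; apply/funext => x; apply: eq_bigr => n _; ring.
Qed.

Lemma coef_derive2 n : cos_coef (g^`(2))%classic n = - ((2 * pi * n%:R) ^+ 2 * cos_coef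
  g n) /\
  sin_coef (g^`(2))%classic n = - ((2 * pi * n%:R) ^+ 2 * sin_coef g n).
Proof.
rewrite g2E; have [-> ->] := coef_trig_series n abs_bounded2; split; first ring.
by case: eqP => [->|_]; ring.
Qed.

End regularity.

(* For Fourier coefficients, this says that h is the Hilbert transform of g''. *)
Definition hilbert_coef g h : Prop := forall n,
  cos_coef h n = (2 * pi * n%:R) ^+ 2 * sin_coef g n /\
  sin_coef h n = - ((2 * pi * n%:R) ^+ 2 * cos_coef g n).

Lemma is_hilbert_coef g h M : continuous g -> periodic g 1 -> weighted_bounded g M ->
  is_hilbert (g^`(2))%classic h -> hilbert_coef g h.
Proof.
move=> cg pg gM [_ _ Hn] n; have [c s] := coef_derive2 cg pg gM n.
(* At frequency 0 the multiplier is 0. For n > 0 it is -i, which exchanges the cosine and sine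
   coefficients up to sign. *)
have := Hn n%:Z; rewrite !fourier_coefE; case: n c s => [_ _|n -> ->].
  rewrite [_%:~R](_ : _ = 0) // mulr0 mul0r => -[E _].
  by rewrite E !sin_coef0 !mulr0 expr0n/= mul0r oppr0.
move=> /eqP; rewrite eq_complex/= => /andP[/eqP E1 /eqP E2].
by split; [rewrite E1; ring|move: E2 => /(congr1 -%R); rewrite opprK => ->; ring].
Qed.

Lemma hilbert_coefB f g h k : continuous f -> continuous g -> continuous h ->
  continuous k ->
  hilbert_coef f h -> hilbert_coef g k -> hilbert_coef (fun x => f x - g x) (fun x => h
    x - k x).
Proof.
move=> cf cg ch ck fh gk n.
have [[E1 E2] [E3 E4]] := (fh n, gk n).
have [-> ->] := coefB n (continuous_fourier_integrable cf)
  (continuous_fourier_integrable cg).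
have [-> ->] := coefB n (continuous_fourier_integrable ch)
  (continuous_fourier_integrable ck).
by rewrite E1 E2 E3 E4; split; ring.
Qed.

(** The dispersive term drops out frequency by frequency: with coefficients a and b of [g], each
    contribution is a multiple of ab - ba. Uniform convergence of the series of [g] allows summing
    inside the integral. *)
Lemma hilbert_orthogonal g h M : continuous g -> periodic g 1 -> weighted_bounded g M ->
  continuous h -> periodic h 1 -> hilbert_coef g h -> int01 (fun x => h x * g x) = 0.
Proof.
move=> cg pg gM ch ph gh.
have [B hB] := periodic_bounded ch ph.
have cF n : continuous (fun x => h x * trig_sum (cos_coef g) (sin_coef g) n x).
  by apply: continuous_funM => //; exact: continuous_trig_sum.
have := uniform_limit_int01 cF (uniform_limit_mul hB (trig_sum_limit_C2 cg pg gM)).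
move=> /cvg_lim => /(_ (@Rhausdorff R)) <-; apply: lim_near_cst => //; apply: nearW => n.
pose F k x := wt R k * (cos_coef g k * (h x * cosn k x) + sin_coef g k * (h x * sinn k x)).
rewrite (_ : (fun _ => _) = fun x => \sum_(k < n) F k x); last first.
  by apply/funext => x; rewrite mulr_sumr; apply: eq_bigr => k _; rewrite /F; ring.
rewrite int01_sum; last by move=> k; rewrite /F; solve_continuous_trig.
apply: big1 => k _; have [c s] := gh k.
rewrite /F int01Z; last by apply: continuous_integrable01; solve_continuous_trig.
rewrite int01D; try by apply: continuous_integrable01; solve_continuous_trig.
rewrite !int01Z; try by apply: continuous_integrable01; solve_continuous_trig.
rewrite -/(cos_coef h k) -/(sin_coef h k) c s; ring.
Qed.

End periodic_C2.

(** * Unique continuation for the Hilbert transform *)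

Section unique_continuation.
Context {R : realType}.
Implicit Types (f g h : R -> R) (x M : R) (n : nat).

Lemma derive_eq0_near f x l d : 0 < d -> (forall y, `|y| < d -> f (x + y) = 0) ->
  is_derive x 1 f l -> l = 0.
Proof.
move=> d0 f0 /is_derive_epsP fl; apply/eqP; rewrite -normr_eq0 eq_le normr_ge0 andbT.
apply/ler_addgt0Pr => e e0; rewrite add0r; have [d' d'0 d'P] := fl _ e0.
pose y := Num.min d d' / 2.
have m0 : 0 < Num.min d d' by rewrite lt_min d0.
have y0 : 0 < y by rewrite /y; lra.
have [yd yd'] : y < d /\ y < d'.
  have : y < Num.min d d' by rewrite /y; lra.
  by rewrite lt_min => /andP.
have := d'P y (lt0r_neq0 y0); rewrite gtr0_norm// => /(_ yd').
have fx : f x = 0 by rewrite -[x]addr0 f0 ?normr0.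
have fxy : f (x + y) = 0 by apply: f0; rewrite gtr0_norm.
by rewrite fx fxy subrr mulr0 sub0r normrN.
Qed.

Lemma normC_le (a b : R) : `|Complex a b| <= ((`|a| + `|b|)%:C)%C.
Proof.
rewrite normc_def /= lecR -[leRHS]ger0_norm ?addr_ge0// -sqrtr_sqr ler_wsqrtr//.
rewrite sqrrD !real_normK ?num_real//; have := mulr_ge0 (normr_ge0 a) (normr_ge0 b); lra.
Qed.

Lemma hilbert_abs_bounded g h M : weighted_bounded g M -> hilbert_coef g h ->
  abs_bounded (cos_coef h) (sin_coef h) ((2 * pi) ^+ 2 * M).
Proof.
move=> gM gh; apply: (abs_bounded_weight gM); first exact: sqr_ge0.
move=> n; have [-> ->] := gh n; rewrite normrN !normrM [`|pi|]ger0_norm ?pi_ge0//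
  ?[`|n%:R|]ger0_norm// ?[`|2|]ger0_norm// -mulrDr.
have : 0 <= `|cos_coef g n| + `|sin_coef g n| by rewrite addr_ge0.
rewrite [X in _ * X <= _]addrC; set X := _ + _ => X0.
rewrite [leLHS](_ : _ = (2 * pi) ^+ 2 * (n%:R ^+ 2 * X)); last by ring.
by rewrite ler_wpM2l ?sqr_ge0// ler_wpM2r// lerDr.
Qed.

Lemma trig_sumS (a b : nat -> R) n x : trig_sum a b n.+1 x =
  trig_sum a b n x + wt R n * (a n * cosn n x + b n * sinn n x).
Proof. by rewrite /trig_sum big_ord_recr. Qed.

(* g'' + i h is the boundary value of a power series: the Fourier coefficients
   of negative index cancel. *)
Lemma hilbert_unique_continuation g h M (p q : R) :
  continuous g -> periodic g 1 -> weighted_bounded g M ->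
  continuous h -> periodic h 1 -> hilbert_coef g h -> p < q ->
  (forall x, p < x < q -> g x = 0) -> (forall x, p < x < q -> h x = 0) ->
  forall x, g x = 0.
Proof.
move=> cg pg gM ch ph gh pq g0 h0.
have near0 x : p < x < q -> exists2 d : R, 0 < d & forall y, `|y| < d -> p < x + y < q.
  move=> /andP[px xq]; exists (Num.min (x - p) (q - x)).
    by rewrite lt_min !subr_gt0 px.
  by move=> y; rewrite lt_min !ltr_norml; lra.
have derive0 (f df : R -> R) : (forall x, is_derive x 1 f (df x)) ->
    (forall x, p < x < q -> f x = 0) -> forall x, p < x < q -> df x = 0.
  move=> dfx f0 x /near0[d d0 dP]; apply: derive_eq0_near d0 _ (dfx x).
  by move=> y /dP; exact: f0.
have gC2 := is_derive_C2 cg pg gM.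
have g1_0 := derive0 _ _ (fun x => (gC2 x).1) g0.
have g2_0 := derive0 _ _ (fun x => (gC2 x).2) g1_0.
have hb := hilbert_abs_bounded gM gh.
have g2_lim := trig_sum_limit_derive2 cg pg gM.
have h_lim := trig_series_uniform hb; rewrite -(fourier_inversion ch ph hb) in h_lim.
(* The coefficients of -(g'' + i h). Positive frequencies count twice because the negative ones
   cancel. *)
pose c n : R[i] := Complex (wt R n * ((2 * pi * n%:R) ^+ 2 * cos_coef g n))
                           (- (wt R n * ((2 * pi * n%:R) ^+ 2 * sin_coef g n))).
have c_sum n x : \sum_(k < n) c k * expi x ^+ k =
    Complex (- trig_sum (fun n => - ((2 * pi * n%:R) ^+ 2 * cos_coef g n))
               (fun n => - ((2 * pi * n%:R) ^+ 2 * sin_coef g n)) n x)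
            (- trig_sum (cos_coef h) (sin_coef h) n x).
  elim: n => [|n IH]; first by rewrite /trig_sum !big_ord0 oppr0.
  rewrite big_ord_recr /= !trig_sumS {}IH expiX /c.
  have [-> ->] := gh n.
  by apply/eqP; rewrite eq_complex /=; apply/andP; split; apply/eqP; ring.
have c_bound n : \sum_(k < n) `|c k| <= ((2 * ((2 * pi) ^+ 2 * M))%:C)%C.
  apply: (@le_trans _ _ ((\sum_(k < n) 2 * (`|cos_coef h k| + `|sin_coef h k|))%:C)%C);
    last first.
    by rewrite lecR -mulr_sumr ler_wpM2l.
  rewrite rmorph_sum; apply: ler_sum => k _; apply: le_trans (normC_le _ _) _.
  have wP (y : R) : `|wt R k * y| <= 2 * `|y|.
    by have /andP[w0 w2] := @wt_bounds R k; rewrite normrM gtr0_norm// ler_wpM2r.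
  have [-> ->] := gh k; rewrite lecR !normrN.
  have := wP ((2 * pi * k%:R) ^+ 2 * cos_coef g k).
  have := wP ((2 * pi * k%:R) ^+ 2 * sin_coef g k); lra.
have c0 := power_series_arc_eq0 pq c_bound _.
have {}c0 : forall n, c n = 0.
  apply: c0 => e e0.
  have e2 : 0 < e / 2 by lra.
  have [[N NP] [N' N'P]] := (g2_lim _ e2, h_lim _ e2).
  exists (maxn N N') => n; rewrite geq_max => /andP[Nn N'n] x xpq.
  rewrite c_sum; apply: le_trans (normC_le _ _) _; rewrite lecR !normrN.
  have := NP n Nn x; have := N'P n N'n x.
  rewrite h0// g2_0// !subr0; lra.
have coef0 n : (0 < n)%N -> cos_coef g n = 0 /\ sin_coef g n = 0.
  move=> n0; have := c0 n => -[/eqP + /eqP].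
  have nz : wt R n * (2 * pi * n%:R) ^+ 2 != 0.
    have /andP[w0 _] := @wt_bounds R n; have pi0 := pi_gt0 R.
    by rewrite gt_eqF// mulr_gt0// exprn_gt0// !mulr_gt0// ltr0n.
  rewrite oppr_eq0 [wt R n * (_ * cos_coef g n)]mulrA [wt R n * (_ * sin_coef g n)]mulrA.
  by rewrite [_ * cos_coef g n == 0]mulf_eq0 [_ * sin_coef g n == 0]mulf_eq0 (negbTE
    nz) => /eqP -> /eqP.
(* The coefficient [c 0] is 0 whatever the mean of [g], so only constancy follows here; the value on
   the arc then settles the constant. *)
have g_cst x : g x = cos_coef g 0.
  apply/eqP; rewrite -subr_eq0 -normr_eq0 eq_le normr_ge0 andbT.
  apply/ler_addgt0Pr => e e0; rewrite add0r.
  have [N /(_ N.+1 (leqnSn _) x)] := trig_sum_limit_C2 cg pg gM e0.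
  rewrite distrC /trig_sum big_ord_recl big1/= => [|i _].
    by rewrite cosn0 sinn0 mul1r mulr1 mulr0 !addr0.
  by have [-> ->] := coef0 (bump 0 i) isT; rewrite !mul0r addr0 mulr0.
move=> x; have mid : p < (p + q) / 2 < q by lra.
by rewrite g_cst -(g_cst ((p + q) / 2)) g0.
Qed.

End unique_continuation.

(** * Regularity of solutions in time *)

Section sobolev_embedding.
Context {R : realType}.
Implicit Types (g : R -> R) (s M : R).

Lemma sobolev_norm_bound s g : sobolev s g ->
  exists2 c : R, 0 < c & (sobolev_norm s g <= c%:E)%E.
Proof.
move=> [_]; have : (0 <= sobolev_norm s g)%E by exact: sqrte_ge0.
case: (sobolev_norm s g) => // r; rewrite lee_fin => r0 _.
by exists (r + 1); [|rewrite lee_fin]; lra.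
Qed.

(** The weight exponent 1 requires s - 2 > 1/2. *)
Lemma sobolev_weighted_bounded s : 5 / 2 < s -> exists2 K : R, 0 < K &
  forall g c, 0 < c -> (sobolev_norm s g <= c%:E)%E -> weighted_bounded g (K * c).
Proof.
move=> s52; have [|K K0 KP] := @sobolev_sum R s 1; first lra.
exists K => // g c c0 gc N; apply: le_trans (KP g c c0 gc N).
by apply: ler_sum => n _; rewrite powRr1// addr_ge0// sqr_ge0.
Qed.

(** Meant for the time derivative, with [s - 2] in place of [s]. *)
Lemma sobolev_abs_bounded s : 2^-1 < s -> exists2 K : R, 0 < K &
  forall g c, 0 < c -> (sobolev_norm s g <= c%:E)%E ->
    abs_bounded (cos_coef g) (sin_coef g) (K * c).
Proof.
move=> s12; have [|K K0 KP] := @sobolev_sum R s 0; first lra.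
exists K => // g c c0 gc N; apply: le_trans (KP g c c0 gc N).
by apply: ler_sum => n _; rewrite powRr0 mul1r.
Qed.

Lemma trig_series_dist (a b a' b' : nat -> R) M M' C x :
  abs_bounded a b M -> abs_bounded a' b' M' ->
  abs_bounded (fun n => a n - a' n) (fun n => b n - b' n) C ->
  `|trig_series a b x - trig_series a' b' x| <= 2 * C.
Proof.
move=> ab ab' abC; apply/ler_addgt0Pr => e e0.
have e2 : 0 < e / 2 by lra.
have [N NP] := trig_series_uniform ab e2; have [N' N'P] := trig_series_uniform ab' e2.
pose n := maxn N N'.
have := NP n (leq_maxl _ _) x; have := N'P n (leq_maxr _ _) x.
have : `|trig_sum a b n x - trig_sum a' b' n x| <= 2 * C.
  have -> : trig_sum a b n x - trig_sum a' b' n x =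
      trig_sum (fun n => a n - a' n) (fun n => b n - b' n) n x.
    by rewrite /trig_sum -sumrB; apply: eq_bigr => k _; ring.
  have := trig_sum_dist (fun n => a n - a' n) (fun n => b n - b' n) x (leq0n n).
  rewrite {2}/trig_sum !big_ord0 !subr0 => H; apply: le_trans H _.
  by rewrite ler_wpM2l.
rewrite !ler_norml.
move: (trig_sum a b n x) (trig_sum a' b' n x) => p q; lra.
Qed.

Lemma weighted_abs_bounded g M : weighted_bounded g M ->
  abs_bounded (cos_coef g) (sin_coef g) M.
Proof.
move=> gM; rewrite -[M]mul1r; apply: (abs_bounded_weight gM) => // n.
by rewrite mul1r ler_peMl ?addr_ge0// lerDl exprn_ge0.
Qed.

Lemma weighted_bounded_normr g M x : continuous g -> periodic g 1 ->
  weighted_bounded g M -> `|g x| <= 2 * M.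
Proof. by move=> cg pg gM; case: (C1_bounds cg pg gM x). Qed.

End sobolev_embedding.

Section time_regularity.
Context {R : realType}.

Lemma cvge0_le (V : Type) (F : set_system V) {FF : Filter F} (N : V -> \bar R) :
  N x @[x --> F] --> 0%E -> forall c : R, 0 < c -> F [set x | (N x <= c%:E)%E].
Proof.
move=> N0 c c0; have : nbhs (0%E : \bar R) [set y | (y < c%:E)%E].
  by have := @open_ereal_lt' R 0%E c%:E; apply; rewrite lte_fin.
by move=> /N0 H; apply: (@filterS _ F _ _ _ _ H) => x /= /ltW.
Qed.

Context (T s : R) (u : R -> R -> R).
Context (s_gt : 5 / 2 < s).
Context (cu : forall t : R, t \in `[0, T] -> continuous (u t)).
Context (su : sobolev_continuous s `[0, T] u).

Lemma solution_periodic t : t \in `[0, T] -> periodic (u t) 1.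
Proof. by move=> tT; have [[pu _ _] _] := su.1 t tT. Qed.

Lemma solution_weighted_bounded_at t : t \in `[0, T] -> exists M, weighted_bounded (u t) M.
Proof.
move=> tT; have [c c0 uc] := sobolev_norm_bound (su.1 t tT).
have [K K0 KP] := sobolev_weighted_bounded s_gt.
by exists (K * c); exact: KP.
Qed.

Lemma solution_close t : t \in `[0, T] -> forall e : R, 0 < e ->
  exists2 d : R, 0 < d & forall t', t' \in `[0, T] -> `|t' - t| < d ->
    weighted_bounded (fun x => u t' x - u t x) e.
Proof.
move=> tT e e0; have [K K0 KP] := sobolev_weighted_bounded s_gt.
have eK : 0 < e / K by exact: divr_gt0.
have [d d0 dP] := cvge0_le (su.2 t tT) eK.
exists d => // t' t'T t'd; rewrite -[e](divfK (lt0r_neq0 K0)) mulrC.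
by apply: KP => //; apply: dP => //; rewrite /ball/= distrC.
Qed.

Lemma solution_time_continuous t : t \in `[0, T] -> forall e : R, 0 < e ->
  exists2 d : R, 0 < d & forall t', t' \in `[0, T] -> `|t' - t| < d ->
    forall x, `|u t' x - u t x| <= e.
Proof.
move=> tT e e0; have [d d0 dP] := solution_close tT (ltac:(lra) : 0 < e / 2).
exists d => // t' t'T t'd x.
rewrite (_ : e = 2 * (e / 2)); last by field.
have [cut cut'] := (cu tT, cu t'T).
apply: (@weighted_bounded_normr _ (fun x => u t' x - u t x)) (dP t' t'T t'd).
  by solve_continuous.
by move=> y; rewrite !solution_periodic.
Qed.

(** A bound at one time holds nearby after adding 1, and [[0, T]] is compact. Gronwall's inequality
    needs a constant independent of time. *)
Lemma solution_weighted_bounded : exists M, forall t, t \in `[0, T] ->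
  weighted_bounded (u t) M.
Proof.
have [M MP] : \forall M \near +oo, `[0, T] `<=` [set t | weighted_bounded (u t) M].
  have /compact_near_coveringP cov := @segment_compact R 0 T.
  suff : \forall M \near +oo, `[0, T] `<=` (fun t => t \in `[0, T] -> weighted_bounded
    (u t) M).
    by apply: filterS => M H t tT; exact: H.
  apply: cov => t tT.
  have [M tM] := solution_weighted_bounded_at tT.
  have [d d0 dP] := solution_close tT ltr01.
  exists ([set t' | `|t - t'| < d], [set M' | M + 1 < M']).
    by split; [exists d => // y|exists (M + 1); split => //; exact: num_real].
  move=> [t' M'] /= [td MM'] t'T N.
  have [cut cut'] := (cu tT, cu t'T).
  apply: le_trans (ltW MM'); apply: le_trans (lerD (tM N) (dP t' t'T _ N)); last by
    rewrite distrC.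
  rewrite -big_split; apply: ler_sum => n _ /=; rewrite -mulrDr ler_wpM2l ?addr_ge0
    ?exprn_ge0//.
  have [-> ->] := coefB n (continuous_fourier_integrable cut')
    (continuous_fourier_integrable cut).
  have := ler_normD (cos_coef (u t) n) (cos_coef (u t') n - cos_coef (u t) n).
  have := ler_normD (sin_coef (u t) n) (sin_coef (u t') n - sin_coef (u t) n).
  rewrite !(addrC _ (_ - _)) !subrK; lra.
by case: MP => _ H; exists (M + 1) => t tT; apply: (H (M + 1)) => //; rewrite ltrDl.
Qed.

(** Since s - 2 > 1/2, convergence in H^(s - 2) makes the coefficients converge in l^1, hence the
    functions uniformly. As [v t] matters only up to null sets, the limit [V] is the sum of its
    Fourier series, its continuous representative. *)
Lemma solution_time_derivative t : sobolev_C1 (s - 2) 0 T u -> t \in `]0, T[ ->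
  exists V : R -> R, forall e : R, 0 < e -> exists2 d : R, 0 < d &
    forall h : R, h != 0 -> `|h| < d ->
      forall x, `|h^-1 * (u (t + h) x - u t x) - V x| <= e.
Proof.
move=> [_ [v [[vs _] dv]]] tT.
have [Lv _] := vs t tT; have Iv := L2_fourier_integrable Lv.
have [|K K0 KP] := @sobolev_abs_bounded R (s - 2); first by move: s_gt; lra.
have tT' : t \in `[0, T] by move: tT; rewrite !in_itv/=; lra.
have [Mt tM] := solution_weighted_bounded_at tT'.
have [r r0 rP] : exists2 r : R, 0 < r & forall h, `|h| < r -> t + h \in `[0, T].
  exists (Num.min t (T - t)); first by move: tT; rewrite in_itv/= lt_min subr_gt0.
  by move=> h; rewrite lt_min !ltr_norml in_itv/=; move: tT; rewrite in_itv/=; lra.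
pose Q h x := h^-1 * (u (t + h) x - u t x).
have cQ h : `|h| < r -> continuous (Q h).
  by move=> /rP /cu c1; have c2 := cu tT'; rewrite /Q; solve_continuous.
have pQ h : `|h| < r -> periodic (Q h) 1.
  by move=> /rP th y; rewrite /Q !solution_periodic.
have coefQ h n : `|h| < r ->
    cos_coef (Q h) n = h^-1 * (cos_coef (u (t + h)) n - cos_coef (u t) n) /\
    sin_coef (Q h) n = h^-1 * (sin_coef (u (t + h)) n - sin_coef (u t) n).
  move=> /rP /cu c1; have c2 := cu tT'.
  have [<- <-] := coefB n (continuous_fourier_integrable c1)
    (continuous_fourier_integrable c2).
  rewrite /cos_coef /sin_coef -!int01Z; try by apply: continuous_integrable01;
    solve_continuous_trig.
  by split; congr int01; apply/funext => x; rewrite /Q mulrA.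
(* The bound obtained may blow up as [h] tends to 0; it is used for one [h] at a time. *)
have abQ h : `|h| < r -> exists M, abs_bounded (cos_coef (Q h)) (sin_coef (Q h)) M.
  move=> hr; have [M thM] := solution_weighted_bounded_at (rP h hr).
  exists (`|h^-1| * (M + Mt)) => N.
  apply: le_trans (ler_wpM2l (normr_ge0 _) (lerD (weighted_abs_bounded thM N)
    (weighted_abs_bounded tM N))).
  rewrite -big_split mulr_sumr; apply: ler_sum => n _ /=.
  have [-> ->] := coefQ h n hr; rewrite !normrM -mulrDr ler_wpM2l//.
  have := ler_normB (cos_coef (u (t + h)) n) (cos_coef (u t) n).
  have := ler_normB (sin_coef (u (t + h)) n) (sin_coef (u t) n); lra.
have closeP c : 0 < c -> exists2 d : R, 0 < d & forall h : R, h != 0 -> `|h| < d ->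
    `|h| < r /\ abs_bounded (fun n => cos_coef (Q h) n - cos_coef (v t) n)
      (fun n => sin_coef (Q h) n - sin_coef (v t) n) (K * c).
  move=> c0; have [d d0 dP] := cvge0_le (dv t tT) c0.
  exists (Num.min d r); first by rewrite lt_min d0.
  move=> h hn0; rewrite lt_min => /andP[hd hr]; split => //.
  have hball : ball 0 d h by rewrite /ball/= sub0r normrN.
  move=> N; apply: le_trans (KP _ c c0 (dP h hball hn0) N).
  apply: ler_sum => n _.
  by have [-> ->] := coefB n (continuous_fourier_integrable (cQ h hr)) Iv.
(* The coefficients of [v t] are dominated by those of a single quotient plus its l^1 distance to
   [v t]. *)
have [Mv vM] : exists M, abs_bounded (cos_coef (v t)) (sin_coef (v t)) M.
  have [d d0 dP] := closeP 1 ltr01.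
  have d2 : `|d / 2| < d by rewrite gtr0_norm; lra.
  have d2n : d / 2 != 0 by rewrite gt_eqF//; lra.
  have [hr hC] := dP _ d2n d2; have [M QM] := abQ _ hr.
  exists (M + K * 1) => N; apply: le_trans (lerD (QM N) (hC N)).
  rewrite -big_split; apply: ler_sum => n _ /=.
  have := ler_normB (cos_coef (Q (d / 2)) n) (cos_coef (Q (d / 2)) n - cos_coef (v t) n).
  have := ler_normB (sin_coef (Q (d / 2)) n) (sin_coef (Q (d / 2)) n - sin_coef (v t) n).
  rewrite !subKr; lra.
exists (trig_series (cos_coef (v t)) (sin_coef (v t))) => e e0.
have eK : 0 < e / (2 * K) by apply: divr_gt0; lra.
have [d d0 dP] := closeP _ eK; exists d => // h hn0 hd x.
have [hr hC] := dP h hn0 hd; have [M QM] := abQ _ hr.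
rewrite -/(Q h x) (fourier_inversion (cQ h hr) (pQ h hr) QM).
have := trig_series_dist x QM vM hC.
by rewrite (_ : 2 * (K * (e / (2 * K))) = e)//; field; exact: lt0r_neq0.
Qed.

End time_regularity.

(** * The energy estimate *)

Section energy.
Context {R : realType}.
Implicit Types (f g w V : R -> R) (x t : R).

Lemma normr_int01_le_int01 g w : continuous g -> continuous w ->
  (forall x, `|g x| <= w x) -> `|int01 g| <= int01 w.
Proof.
move=> cg cw gw; rewrite ler_norml; apply/andP; split; last first.
  by apply: le_int01 => // x; exact: le_trans (ler_norm _) (gw x).
rewrite -mulN1r -int01Z; last exact: continuous_integrable01.
apply: le_int01 => [|//|x]; first by solve_continuous.
by rewrite mulN1r; have := gw x; rewrite ler_norml => /andP[].
Qed.

Lemma smooth_is_derive f n x : smooth f ->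
  is_derive x 1 (f^`(n))%classic ((f^`(n.+1))%classic x).
Proof. by move=> /(_ n x) fn; rewrite /= derive1E; apply: DeriveDef. Qed.

Lemma smooth_continuous f n : smooth f -> continuous (f^`(n))%classic.
Proof. by move=> sf x; exact: is_derive_continuous (smooth_is_derive n x sf). Qed.

Lemma smooth_bounded f n M : smooth f -> exists2 K, 0 <= K &
  forall x, `|x| <= M -> `|(f^`(n))%classic x| <= K.
Proof.
move=> sf; have [M0|M0] := ltP M 0.
  by exists 0 => // x xM; have := lt_le_trans M0 (normr_ge0 x); rewrite ltNge xM.
have cn : continuous (fun x => `|(f^`(n))%classic x|).
  by move=> x; apply: cvg_norm; exact: smooth_continuous.
have MM : - M <= M by lra.
have [c _ cP] := EVT_max MM (continuous_subspaceT cn).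
exists `|(f^`(n))%classic c| => // x; rewrite ler_norml => xM; apply: cP.
by rewrite in_itv.
Qed.

(* Integrating by parts in the term carrying w' = d1 - d2 leaves only w ^ 2. *)
Lemma energy_estimate f (M M' : R) : smooth f ->
  exists2 C : R, 0 <= C & forall (u1 u2 d1 d2 h V : R -> R),
  (forall x, is_derive x 1 u1 (d1 x)) -> (forall x, is_derive x 1 u2 (d2 x)) ->
  continuous d1 -> continuous d2 -> periodic u1 1 -> periodic u2 1 ->
  (forall x, `|u1 x| <= M) -> (forall x, `|u2 x| <= M) ->
  (forall x, `|d1 x| <= M') -> (forall x, `|d2 x| <= M') ->
  continuous h -> int01 (fun x => h x * (u1 x - u2 x)) = 0 ->
  (forall x, V x = h x - ((f^`())%classic (u1 x) * d1 x - (f^`())%classic (u2 x) * d2 x)) ->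
  `|2 * int01 (fun x => (u1 x - u2 x) * V x)| <= C * int01 (fun x => (u1 x - u2 x) ^+ 2).
Proof.
move=> sf; have [K K0 KP] := smooth_bounded 2 M sf.
(* The remainder is at most (1/2 + 1) K |M'| w^2, from half of f''(u1) u1' and from the Lipschitz
   bound of f'; then comes the factor 2. The constant is fixed before the functions, so it serves
   all times at once. *)
exists (3 * K * `|M'|); first by rewrite !mulr_ge0.
move=> u1 u2 d1 d2 h V du1 du2 cd1 cd2 p1 p2 u1M u2M d1M d2M ch hw VE.
have cu1 : continuous u1 by move=> x; exact: is_derive_continuous (du1 x).
have cu2 : continuous u2 by move=> x; exact: is_derive_continuous (du2 x).
have M'0 : M' = `|M'| by rewrite ger0_norm//; exact: le_trans (normr_ge0 _) (d1M 0).
pose f1 := (f^`())%classic; pose f2 := (f^`(2))%classic.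
have df1 x : is_derive x 1 f1 (f2 x) by exact: (smooth_is_derive 1 x sf).
have cf1 : continuous f1 by move=> x; exact: is_derive_continuous (df1 x).
have cf2 : continuous f2.
  by move=> x; exact: is_derive_continuous (smooth_is_derive 2 x sf).
have cf1u1 := continuous_fun_comp cf1 cu1; have cf1u2 := continuous_fun_comp cf1 cu2.
have cf2u1 := continuous_fun_comp cf2 cu1.
pose w x := u1 x - u2 x.
have cw : continuous w by rewrite /w; solve_continuous.
(* The derivative of f'(u1) w^2 / 2, hence of mean 0. Writing f'(u1) d1 - f'(u2) d2 as f'(u1) w' +
   (f'(u1) - f'(u2)) d2, subtracting [P] removes w'. *)
pose P x := w x * (d1 x - d2 x) * f1 (u1 x) + 2^-1 * (w x ^+ 2 * (f2 (u1 x) * d1 x)).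
have cP : continuous P by rewrite /P; solve_continuous.
have P0 : int01 P = 0.
  apply: (@int01_derive_periodic _ (fun x => 2^-1 * (w x * w x * f1 (u1 x)))) => //.
  - move=> x; have dw : is_derive x 1 w (d1 x - d2 x) by exact: is_derive_funB.
    apply: is_derive_eq (is_derive_funZ _ (is_derive_funM (is_derive_funM dw dw)
      (is_derive_fun_comp (df1 (u1 x)) (du1 x)))) _.
    by rewrite /P; field.
  - by move=> x; rewrite /w p1 p2.
pose rest x := 2^-1 * (w x ^+ 2 * (f2 (u1 x) * d1 x)) - w x * (f1 (u1 x) - f1 (u2 x)) *
  d2 x.
have crest : continuous rest by rewrite /rest; solve_continuous.
have -> : int01 (fun x => w x * V x) = int01 rest.
  rewrite (_ : (fun x => w x * V x) = fun x => (h x * w x - P x) + rest x); last first.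
    by apply/funext => x; rewrite VE /P /rest -/f1 /w; ring.
  rewrite int01D; try by apply: continuous_integrable01; solve_continuous.
  rewrite int01B; try by apply: continuous_integrable01; solve_continuous.
  by rewrite P0 hw subr0 add0r.
rewrite normrM [`|2|]ger0_norm//.
suff : `|int01 rest| <= int01 (fun x => 3 / 2 * K * `|M'| * (w x) ^+ 2).
  rewrite int01Z; last by apply: continuous_integrable01; solve_continuous.
  rewrite -/w; lra.
apply: normr_int01_le_int01; [by solve_continuous|by solve_continuous|] => x.
have lip : `|f1 (u1 x) - f1 (u2 x)| <= K * `|w x|.
  apply: mean_value_dist => // y /andP[y1 y2]; apply: KP.
  have := u1M x; have := u2M x; rewrite !ler_norml.
  move: y1 y2; rewrite ge_min le_max; lra.
have f2K : `|f2 (u1 x)| <= K by exact: KP.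
have A : `|f2 (u1 x) * d1 x| <= K * `|M'|.
  by rewrite normrM ler_pM// -M'0.
have B : `|w x * (f1 (u1 x) - f1 (u2 x)) * d2 x| <= `|w x| * (K * `|w x|) * `|M'|.
  by rewrite !normrM ler_pM ?mulr_ge0// -?M'0// ler_wpM2l.
have w2 : `|w x| * (K * `|w x|) = K * w x ^+ 2.
  by rewrite -[w x ^+ 2]real_normK ?num_real//; ring.
have D : `|w x ^+ 2 * (f2 (u1 x) * d1 x)| <= w x ^+ 2 * (K * `|M'|).
  by rewrite normrM ger0_norm ?sqr_ge0// ler_wpM2l ?sqr_ge0.
move: B D; rewrite w2 /rest !ler_norml.
move: (w x * (f1 (u1 x) - f1 (u2 x)) * d2 x) (w x ^+ 2 * (f2 (u1 x) * d1 x)) => p q.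
move: (w x ^+ 2) => W; lra.
Qed.

(** With [Q] the difference quotient of [W], that of W^2 is 2WQ + hQ^2. Its distance to 2WV is 2W(Q
    - V) + hQ^2, small uniformly in x. *)
Lemma is_derive_energy (W : R -> R -> R) t (V : R -> R) (r B B' : R) : 0 < r ->
  (forall h, `|h| < r -> continuous (W (t + h))) -> continuous V ->
  (forall x, `|W t x| <= B) -> (forall x, `|V x| <= B') ->
  (forall e : R, 0 < e -> exists2 d : R, 0 < d & forall h : R, h != 0 -> `|h| < d ->
      forall x, `|h^-1 * (W (t + h) x - W t x) - V x| <= e) ->
  is_derive t 1 (fun t => int01 (fun x => W t x ^+ 2)) (2 * int01 (fun x => W t x * V x)).
Proof.
move=> r0 cW cV WB VB dW; apply/is_derive_epsP => e e0.
have B0 : 0 <= B by exact: le_trans (normr_ge0 _) (WB 0).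
have B'0 : 0 <= B' by exact: le_trans (normr_ge0 _) (VB 0).
(* The 1 bounds [Q] by [B' + 1]; the other term gives 2W(Q - V) half of [e], and the choice of [d']
   does the same for hQ^2. *)
pose dl := Num.min 1 (e / 2 / (2 * B + 1)).
have dl0 : 0 < dl by rewrite lt_min ltr01 !divr_gt0//; lra.
have dl1 : dl <= 1 by rewrite ge_min lexx.
have dlB : dl * (2 * B + 1) <= e / 2.
  by rewrite -ler_pdivlMr ?ge_min ?lexx ?orbT//; lra.
have [d d0 dP] := dW dl dl0.
pose d' := Num.min (Num.min d r) (e / 2 / ((B' + 1) ^+ 2 + 1)).
have BB : 0 <= (B' + 1) ^+ 2 by exact: sqr_ge0.
have d'0 : 0 < d' by rewrite !lt_min d0 r0 !divr_gt0//; lra.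
exists d' => // h hn0; rewrite !lt_min => /andP[/andP[hd hr] hB].
have c0 : continuous (W t) by rewrite -[t]addr0; apply: cW; rewrite normr0.
have c1 := cW h hr.
pose Q x := h^-1 * (W (t + h) x - W t x).
have -> : h^-1 * (int01 (fun x => W (t + h) x ^+ 2) - int01 (fun x => W t x ^+ 2)) -
    2 * int01 (fun x => W t x * V x) = int01 (fun x => 2 * W t x * (Q x - V x) + h * Q
      x ^+ 2).
  rewrite -int01B; try by apply: continuous_integrable01; solve_continuous.
  rewrite -!int01Z; try by apply: continuous_integrable01; solve_continuous.
  rewrite -int01B; try by apply: continuous_integrable01; solve_continuous.
  by congr int01; apply/funext => x; rewrite /Q; field.
apply: normr_int01_le => [|x]; first by rewrite /Q; solve_continuous.
have QV : `|Q x - V x| <= dl by exact: dP.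
have Qb : `|Q x| <= B' + 1.
  have := VB x; move: QV; rewrite !ler_norml; lra.
have hQ : `|h * Q x ^+ 2| <= e / 2.
  rewrite normrM normrX; move: hB; rewrite ltr_pdivlMr; last by lra.
  have : `|Q x| ^+ 2 <= (B' + 1) ^+ 2 by rewrite lerXn2r// nnegrE; lra.
  have := normr_ge0 h; nra.
have wQ : `|2 * W t x * (Q x - V x)| <= e / 2.
  rewrite -mulrA normrM [`|2|]ger0_norm// normrM.
  have : `|W t x| * `|Q x - V x| <= B * dl by apply: ler_pM.
  lra.
by apply: le_trans (ler_normD _ _) _; lra.
Qed.

Lemma nonincreasing_of_derive (F dF : R -> R) (a b : R) : a <= b ->
  (forall x, a <= x <= b -> is_derive x 1 F (dF x)) ->
  (forall x, a <= x <= b -> dF x <= 0) -> F b <= F a.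
Proof.
move=> ab dFx dF0.
have cF : {within `[a, b], continuous F}.
  apply: continuous_in_subspaceT => x; rewrite inE/= in_itv/= => xab.
  exact: is_derive_continuous (dFx x xab).
have dF' x : x \in `]a, b[ -> is_derive x 1 F (dF x).
  by rewrite in_itv/= => /andP[? ?]; apply: dFx; rewrite !ltW.
have [c] := MVT_segment ab dF' cF; rewrite in_itv/= => cab E.
by rewrite -subr_le0 E mulr_le0_ge0 ?subr_ge0// dF0.
Qed.

(** The two-sided bound on [dE] makes exp (-Ct) E nonincreasing and exp (Ct) E nondecreasing: the
    first settles times after [t0], the second times before. *)
Lemma gronwall_eq0 (E dE : R -> R) (T C t0 : R) : t0 \in `]0, T[ -> E t0 = 0 ->
  (forall t, 0 <= E t) ->
  (forall t, t \in `]0, T[ -> is_derive t 1 E (dE t)) ->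
  (forall t, t \in `]0, T[ -> `|dE t| <= C * E t) ->
  forall t, t \in `]0, T[ -> E t = 0.
Proof.
move=> t0T Et0 E0 dEt dEC.
have dexp c x : is_derive x 1 (fun y : R => expR (c * y)) (expR (c * x) * c).
  apply: is_derive_eq (is_derive_fun_comp (is_derive_expR _) (is_derive_funZ c
    (is_derive_id _ _))) _.
  by rewrite mulr1.
have dG c x : x \in `]0, T[ -> is_derive x 1 (fun y => expR (c * y) * E y)
    (expR (c * x) * (c * E x + dE x)).
  move=> xT; apply: is_derive_eq (is_derive_funM (dexp c x) (dEt x xT)) _; ring.
move=> t tT; apply/eqP; rewrite eq_le E0 andbT.
have [le_t|/ltW le_t] := leP t0 t.
  have sub x : t0 <= x <= t -> x \in `]0, T[.
    by move: t0T tT; rewrite !in_itv/=; lra.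
  have := @nonincreasing_of_derive (fun y => expR (- C * y) * E y)
    (fun x => expR (- C * x) * (- C * E x + dE x)) t0 t le_t.
  rewrite Et0 mulr0 pmulr_rle0 ?expR_gt0//; apply => x /sub xT; first exact: dG.
  rewrite pmulr_rle0 ?expR_gt0//; have := dEC x xT; rewrite ler_norml; lra.
have sub x : t <= x <= t0 -> x \in `]0, T[.
  by move: t0T tT; rewrite !in_itv/=; lra.
have := @nonincreasing_of_derive (fun y => -1 * (expR (C * y) * E y))
  (fun x => -1 * (expR (C * x) * (C * E x + dE x))) t t0 le_t.
rewrite Et0 !mulr0 !mulN1r oppr_ge0 pmulr_rle0 ?expR_gt0//; apply => x /sub xT.
  by apply: is_derive_funZ; exact: dG.
rewrite mulN1r oppr_le0 pmulr_rge0 ?expR_gt0//; have := dEC x xT; rewrite ler_norml; lra.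
Qed.

End energy.

(** * Solutions of the equation *)

Section solutions.
Context {R : realType}.
Context (T s : R) (f : R -> R).
Context (s_gt : 5 / 2 < s) (f_smooth : smooth f).
Implicit Types (u : R -> R -> R) (t x : R).

(** Identifies the pointwise time derivative in the equation with the limit [V], uniform in x, and
    expands the nonlinear term by the chain rule. *)
Lemma solution_equation u t : bo_solution T s f u -> t \in `]0, T[ ->
  exists h V : R -> R,
    [/\ continuous h, periodic h 1, hilbert_coef (u t) h,
        (forall e : R, 0 < e -> exists2 d : R, 0 < d & forall k : R, k != 0 -> `|k| < d ->
          forall x, `|k^-1 * (u (t + k) x - u t x) - V x| <= e) &
        forall x, V x = h x - (f^`())%classic (u t x) * ((u t)^`())%classic x].
Proof.
move=> [cu su uC1 eqn] tT.
have tT' : t \in `[0, T] by move: tT; rewrite !in_itv/=; lra.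
have [h [ch hilb hE]] := eqn t tT.
have [V VP] := solution_time_derivative s_gt cu su uC1 tT.
have cut := cu t tT'; have put := solution_periodic su tT'.
have [M uM] := solution_weighted_bounded_at s_gt su tT'.
exists h, V; split => //.
- by have [_ []] := hilb.
- exact: is_hilbert_coef cut put uM hilb.
move=> x; have := hE x.
have -> : ((u ^~ x)^`())%classic t = V x.
  rewrite derive1E; apply: derive_val; apply/is_derive_epsP => e e0.
  by have [d d0 dP] := VP e e0; exists d => // k k0 kd; exact: dP.
have -> : ((f \o u t)^`())%classic x = (f^`())%classic (u t x) * ((u t)^`())%classic x.
  rewrite derive1E; apply: derive_val.
  exact: (is_derive_fun_comp (smooth_is_derive 0 (u t x) f_smooth) (is_derive_C2 cut
    put uM x).1).
lra.
Qed.

(** A solution vanishing on the open set is compared with this one. *)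
Lemma zero_solution : bo_solution T s f (fun _ _ => 0).
Proof.
have der0 (c : R) : ((fun _ : R => c)^`())%classic = fun=> 0.
  by apply: is_derive_derive1 => x; exact: is_derive_cst.
have L0 : L2_circle (fun _ : R => 0).
  split=> //; exact: (continuous_integrable01 (@continuous_fun_cst R (0 ^+ 2))).
have F0 (n : int) : fourier (fun _ : R => 0) n = 0.
  have I0 (k : R -> R) : int01 (fun x => 0 * k x) = 0.
    by rewrite -[RHS](int01_cst 0); congr int01; apply/funext => x; rewrite mul0r.
  by rewrite /fourier -!/(int01 _) !I0 oppr0.
have N0 r : sobolev_norm r (fun _ : R => 0) = 0%E.
  rewrite /sobolev_norm esum1 ?sqrte0// => n _.
  by rewrite F0 ComplexField.Normc.normc0 expr0n mulr0.
have S0 r : sobolev r (fun _ : R => 0) by split => //; rewrite N0.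
have diff0 : (fun _ : R => 0) \- (fun=> 0) = (fun=> 0) :> (R -> R).
  by apply/funext => x /=; rewrite subr0.
split.
- by move=> t _; exact: continuous_fun_cst.
- by split => // t _; rewrite diff0 N0; exact: cvg_cst.
- split => //; exists (fun _ _ => 0); split.
    by split => // t _; rewrite diff0 N0; exact: cvg_cst.
  move=> t _; rewrite /sobolev_is_derive.
  have -> : (fun h : R => sobolev_norm (s - 2) (fun x : R => h^-1 * (0 - 0) - 0)) =
    fun=> 0%E.
    apply/funext => h; rewrite -(N0 (s - 2)); congr sobolev_norm.
    by apply/funext => x; rewrite !subr0 mulr0.
  exact: cvg_cst.
move=> t _; exists (fun=> 0); split.
- exact: continuous_fun_cst.
- by split; rewrite /= ?der0// => n; rewrite !F0 mulr0.
by move=> x; rewrite (_ : f \o _ = fun=> f 0)// !der0 subr0 addr0.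
Qed.

Section two_solutions.
Context (u1 u2 : R -> R -> R).
Context (u1_sol : bo_solution T s f u1) (u2_sol : bo_solution T s f u2).

Let w t x := u1 t x - u2 t x.

Let itvW t : t \in `]0, T[ -> t \in `[0, T].
Proof. by rewrite !in_itv/=; lra. Qed.

(** Equality on a time interval around [t] makes the time derivatives agree on the arc, and equality
    on the arc makes the derivatives of f(u1) and f(u2) agree there. Subtracting the two equations
    leaves [h1 - h2 = 0] on the arc. *)
Lemma eq_at_time_of_eq_near t (p q d : R) : t \in `]0, T[ -> p < q -> 0 < d ->
  (forall t' x, `|t' - t| < d -> p < x < q -> u1 t' x = u2 t' x) ->
  forall x, u1 t x = u2 t x.
Proof.
move=> tT pq d0 eq12; have tT' := itvW tT.
have [[cu1 su1 _ _] [cu2 su2 _ _]] := (u1_sol, u2_sol).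
have [h1 [V1 [ch1 ph1 hc1 dV1 E1]]] := solution_equation u1_sol tT.
have [h2 [V2 [ch2 ph2 hc2 dV2 E2]]] := solution_equation u2_sol tT.
have [M1 uM1] := solution_weighted_bounded_at s_gt su1 tT'.
have [M2 uM2] := solution_weighted_bounded_at s_gt su2 tT'.
have [c1 c2] := (cu1 t tT', cu2 t tT').
have [p1 p2] := (solution_periodic su1 tT', solution_periodic su2 tT').
have wt0 x : p < x < q -> u1 t x = u2 t x by apply: eq12; rewrite subrr normr0.
have ww x : w t x = 0.
  apply: (@hilbert_unique_continuation _ (w t) (fun x => h1 x - h2 x) (M1 + M2) p q) => //.
  - exact: continuous_funB.
  - by move=> y; rewrite /w p1 p2.
  - by apply: weighted_boundedB => //; exact: continuous_fourier_integrable.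
  - exact: continuous_funB.
  - by move=> y; rewrite ph1 ph2.
  - exact: hilbert_coefB.
  - by move=> y /wt0 E; rewrite /w E subrr.
  move=> {}x xpq.
  have V12 : V1 x - V2 x = 0.
    apply: (@derive_eq0_near _ (fun t' => w t' x) t _ d) => //.
      by move=> y yd; rewrite /w eq12 ?subrr// addrAC subrr add0r.
    apply: is_derive_funB; apply/is_derive_epsP => e e0.
      by have [r r0 rP] := dV1 e e0; exists r => // k k0 kr; exact: rP.
    by have [r r0 rP] := dV2 e e0; exists r => // k k0 kr; exact: rP.
  have f12 : (f^`())%classic (u1 t x) * ((u1 t)^`())%classic x -
             (f^`())%classic (u2 t x) * ((u2 t)^`())%classic x = 0.
    apply: (@derive_eq0_near _ (fun y => f (u1 t y) - f (u2 t y)) x _ (Num.min (x - p)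
      (q - x))).
    - by move: xpq; rewrite lt_min !subr_gt0.
    - move=> y; rewrite lt_min !ltr_norml => yd; rewrite wt0 ?subrr//; lra.
    apply: is_derive_funB; apply: is_derive_fun_comp.
    - exact: (smooth_is_derive 0).
    - exact: (is_derive_C2 c1 p1 uM1 x).1.
    - exact: (smooth_is_derive 0).
    - exact: (is_derive_C2 c2 p2 uM2 x).1.
  move: V12; rewrite E1 E2; lra.
by move=> x; apply/eqP; rewrite -subr_eq0; apply/eqP; exact: ww.
Qed.

Lemma eq_of_eq_at_time t0 : t0 \in `]0, T[ -> (forall x, u1 t0 x = u2 t0 x) ->
  forall t x, t \in `[0, T] -> u1 t x = u2 t x.
Proof.
move=> t0T eq0.
have [[cu1 su1 _ _] [cu2 su2 _ _]] := (u1_sol, u2_sol).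
have [M1 uM1] := solution_weighted_bounded s_gt cu1 su1.
have [M2 uM2] := solution_weighted_bounded s_gt cu2 su2.
(* The sup bounds of [C1_bounds], common to both solutions and to all times. *)
pose B := 2 * Num.max M1 M2; pose B' := 2 * (2 * pi * Num.max M1 M2).
have [C C0 CP] := energy_estimate B B' f_smooth.
pose E t := int01 (fun x => w t x ^+ 2).
have bounds u (M : R) t x : M <= Num.max M1 M2 -> continuous (u t) -> periodic (u t) 1 ->
    weighted_bounded (u t) M -> `|u t x| <= B /\ `|((u t)^`())%classic x| <= B'.
  move=> MM c p b; have [b0 b1] := C1_bounds c p b x; have pi0 := pi_ge0 R.
  rewrite /B /B'; split; first by apply: le_trans b0 _; rewrite ler_pM2l.
  by apply: le_trans b1 _; rewrite !ler_pM2l ?pi_gt0// -?mulrA ?mulr_gt0 ?pi_gt0//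
    ler_wpM2l.
have dEP t : t \in `]0, T[ -> exists dE, is_derive t 1 E dE /\ `|dE| <= C * E t.
  move=> tT; have tT' := itvW tT.
  have [h1 [V1 [ch1 ph1 hc1 dV1 E1]]] := solution_equation u1_sol tT.
  have [h2 [V2 [ch2 ph2 hc2 dV2 E2]]] := solution_equation u2_sol tT.
  have [c1 c2] := (cu1 t tT', cu2 t tT').
  have [p1 p2] := (solution_periodic su1 tT', solution_periodic su2 tT').
  have [b1 b2] := (uM1 t tT', uM2 t tT').
  have [[cd1 _] [cd2 _]] := (continuous_C2 c1 p1 b1, continuous_C2 c2 p2 b2).
  have cf1 : continuous (f^`())%classic.
    by move=> y; exact: is_derive_continuous (smooth_is_derive 1 y f_smooth).
  have cfu1 := continuous_fun_comp cf1 c1; have cfu2 := continuous_fun_comp cf1 c2.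
  have cw : continuous (w t) by exact: continuous_funB.
  have pw : periodic (w t) 1 by move=> y; rewrite /w p1 p2.
  have cV : continuous (fun x => V1 x - V2 x).
    have -> : (fun x => V1 x - V2 x) = fun x => (h1 x - (f^`())%classic (u1 t x) * ((u1
      t)^`())%classic x)
        - (h2 x - (f^`())%classic (u2 t x) * ((u2 t)^`())%classic x).
      by apply/funext => x; rewrite E1 E2.
    by solve_continuous.
  (* Periodicity of the space derivatives makes [V1 - V2] periodic, and so bounded. *)
  have pd u : (forall x, is_derive x 1 (u t) (((u t)^`())%classic x)) -> periodic (u t)
    1 -> periodic ((u t)^`())%classic 1.
    move=> du pu x; have [d1 d2] := (du x, du (x + 1)).
    have d3 : is_derive x 1 (fun y => u t (y + 1)) (((u t)^`())%classic (x + 1)).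
      have ds : is_derive x 1 (fun y : R => y + 1) (1 + 0).
        exact: (is_derive_funD (is_derive_id x (1 : R)) (is_derive_cst (1 : R) x 1)).
      apply: is_derive_eq (@is_derive_fun_comp _ (u t) (fun y => y + 1) x _ _ d2 ds) _.
      by rewrite addr0 mulr1.
    have [_ <-] := d3; have [_ <-] := d1; congr ('D_1 _ x).
    by apply/funext => y; exact: pu.
  have du1 x := (is_derive_C2 c1 p1 b1 x).1.
  have du2 x := (is_derive_C2 c2 p2 b2 x).1.
  have pV : periodic (fun x => V1 x - V2 x) 1.
    by move=> x; rewrite !E1 !E2 ph1 ph2 p1 p2 (pd u1 du1 p1) (pd u2 du2 p2).
  have [Bw wB] := periodic_bounded cw pw; have [BV VB] := periodic_bounded cV pV.
  have wM := weighted_boundedB (continuous_fourier_integrable c1)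
    (continuous_fourier_integrable c2) b1 b2.
  exists (2 * int01 (fun x => w t x * (V1 x - V2 x))); split.
    apply: (@is_derive_energy _ w t _ (Num.min t (T - t)) Bw BV) => //.
    - by move: tT; rewrite in_itv/= lt_min subr_gt0.
    - move=> k; rewrite lt_min !ltr_norml => kt.
      have thT : t + k \in `[0, T] by move: tT; rewrite !in_itv/=; lra.
      by apply: continuous_funB; [exact: cu1|exact: cu2].
    move=> e e0; have e2 : 0 < e / 2 by lra.
    have [[r1 r10 r1P] [r2 r20 r2P]] := (dV1 _ e2, dV2 _ e2).
    exists (Num.min r1 r2); first by rewrite lt_min r10.
    move=> k k0; rewrite lt_min => /andP[k1 k2] x.
    have := r1P k k0 k1 x; have := r2P k k0 k2 x; rewrite /w.
    have -> : k^-1 * (u1 (t + k) x - u2 (t + k) x - (u1 t x - u2 t x)) =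
      k^-1 * (u1 (t + k) x - u1 t x) - k^-1 * (u2 (t + k) x - u2 t x) by ring.
    rewrite !ler_norml; move: (k^-1 * _) (k^-1 * _) => P Q; lra.
  apply: (CP (u1 t) (u2 t) ((u1 t)^`())%classic ((u2 t)^`())%classic (fun x => h1 x -
    h2 x)) => //.
  - by move=> x; case: (bounds u1 M1 t x _ c1 p1 b1); rewrite ?le_max ?lexx.
  - by move=> x; case: (bounds u2 M2 t x _ c2 p2 b2); rewrite ?le_max ?lexx ?orbT.
  - by move=> x; case: (bounds u1 M1 t x _ c1 p1 b1); rewrite ?le_max ?lexx.
  - by move=> x; case: (bounds u2 M2 t x _ c2 p2 b2); rewrite ?le_max ?lexx ?orbT.
  - exact: continuous_funB.
  - apply: (hilbert_orthogonal cw pw wM).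
    + exact: continuous_funB.
    + by move=> y; rewrite ph1 ph2.
    + exact: hilbert_coefB.
  by move=> x; rewrite E1 E2; ring.
have [dE dEs] : exists dE : R -> R, forall t, t \in `]0, T[ ->
    is_derive t 1 E (dE t) /\ `|dE t| <= C * E t.
  have /choice[dE H] : forall t, exists l, t \in `]0, T[ -> is_derive t 1 E l /\ `|l|
    <= C * E t.
    move=> t; have [/dEP[l lP]|tn] := boolP (t \in `]0, T[); first by exists l.
    by exists 0.
  by exists dE.
have E0 t : t \in `]0, T[ -> E t = 0.
  apply: (gronwall_eq0 t0T _ _ (fun t tT => (dEs t tT).1) (fun t tT => (dEs t tT).2)).
    rewrite /E -[RHS](int01_cst 0); congr int01; apply/funext => x.
    by rewrite /w eq0 subrr expr0n.
  by move=> r; apply: int01_ge0 => x; exact: sqr_ge0.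
have w0 t x : t \in `]0, T[ -> u1 t x = u2 t x.
  move=> tT; have tT' := itvW tT; have [c1 c2] := (cu1 t tT', cu2 t tT').
  have [p1 p2] := (solution_periodic su1 tT', solution_periodic su2 tT').
  apply/eqP; rewrite -subr_eq0 -sqrf_eq0; apply/eqP.
  apply: (@int01_eq0 _ (fun x => w t x ^+ 2)); last exact: E0.
  - by rewrite /w; solve_continuous.
  - by move=> y; rewrite /w p1 p2.
  - by move=> y; exact: sqr_ge0.
move=> t x tT; apply/eqP; rewrite -subr_eq0 -normr_eq0 eq_le normr_ge0 andbT.
apply/ler_addgt0Pr => e e0; rewrite add0r.
have e2 : 0 < e / 2 by lra.
have [d1 d10 d1P] := solution_time_continuous s_gt cu1 su1 tT e2.
have [d2 d20 d2P] := solution_time_continuous s_gt cu2 su2 tT e2.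
(* As [t] may be 0 or [T], a nearby interior time is taken: a later one if [t <= t0], an earlier one
   otherwise. *)
have [t' [t'T t'd1 t'd2]] : exists t', [/\ t' \in `]0, T[, `|t' - t| < d1 & `|t' - t| < d2].
  pose m := Num.min d1 d2; have m0 : 0 < m by rewrite lt_min d10.
  have md1 : m <= d1 by rewrite ge_min lexx.
  have md2 : m <= d2 by rewrite ge_min lexx orbT.
  move: t0T tT; rewrite !in_itv/= => t0T tT.
  have [tt0|tt0] := leP t t0.
    exists (t + Num.min m (T - t) / 2).
    have : Num.min m (T - t) <= m by rewrite ge_min lexx.
    have : Num.min m (T - t) <= T - t by rewrite ge_min lexx orbT.
    have : 0 < Num.min m (T - t) by rewrite lt_min m0; lra.
    by rewrite !in_itv/= !ltr_norml; split; lra.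
  exists (t - Num.min m t / 2).
  have : Num.min m t <= m by rewrite ge_min lexx.
  have : Num.min m t <= t by rewrite ge_min lexx orbT.
  have : 0 < Num.min m t by rewrite lt_min m0; lra.
  by rewrite !in_itv/= !ltr_norml; split; lra.
have := d1P t' (itvW t'T) t'd1 x; have := d2P t' (itvW t'T) t'd2 x.
rewrite (w0 t' x t'T) !ler_norml; lra.
Qed.

Lemma eq_of_eq_on_open (Omega : set (R * R)) : 0 < T -> open_cylinder T Omega ->
  Omega !=set0 -> (forall x t, Omega (x, t) -> u1 t x = u2 t x) ->
  forall x t, t \in `[0, T] -> u1 t x = u2 t x.
Proof.
move=> T0 [_ [U openU OmegaE]] [[x0 t0] Oxt] eq12 x t tT.
move: (Oxt); rewrite OmegaE => -[U0 /= t0T].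
have [[A B] [[a a0 aA] [b b0 bB]] AB] : nbhs (x0, t0) U by exact: open_nbhs_nbhs.
have inO y r : `|y - x0| < a -> `|r - t0| < b -> r \in `[0, T] -> Omega (y, r).
  move=> ya rb rT; rewrite OmegaE; split => //; apply: AB; split => /=.
    by apply: aA; rewrite /ball/= distrC.
  by apply: bB; rewrite /ball/= distrC.
have [t1 [d [t1T d0 t1d]]] : exists t1 d, [/\ t1 \in `]0, T[, 0 < d &
    forall t', `|t' - t1| < d -> `|t' - t0| < b /\ t' \in `[0, T]].
  move: t0T; rewrite in_itv/= => t0T.
  have [tt0|tt0] := ltP t0 T.
    pose m := Num.min b (T - t0); exists (t0 + m / 2), (m / 2).
    have : m <= b by rewrite ge_min lexx.
    have : m <= T - t0 by rewrite ge_min lexx orbT.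
    have : 0 < m by rewrite lt_min b0; lra.
    move=> *; rewrite in_itv/=; split; [lra|lra|].
    by move=> t'; rewrite !ltr_norml in_itv/= => ?; split; lra.
  pose m := Num.min b t0; exists (t0 - m / 2), (m / 2).
  have : m <= b by rewrite ge_min lexx.
  have : m <= t0 by rewrite ge_min lexx orbT.
  have : 0 < m by rewrite lt_min b0; lra.
  move=> *; rewrite in_itv/=; split; [lra|lra|].
  by move=> t'; rewrite !ltr_norml in_itv/= => ?; split; lra.
apply: (eq_of_eq_at_time t1T) => //.
have a0' : 0 < a :> R := a0.
apply: (@eq_at_time_of_eq_near t1 (x0 - a) (x0 + a) d) => //; first by lra.
move=> t' y /t1d[t'b t'T] ya; apply: eq12; apply: inO => //.
by rewrite ltr_norml; lra.
Qed.

End two_solutions.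
End solutions.

Theorem theorem1p5 (R : realType) (T s : R) (f : R -> R) (u1 u2 : R -> R -> R)
    (T_gt0 : 0 < T) (s_gt : 5 / 2 < s)
    (f_smooth : smooth f) (f0 : f 0 = 0)
    (u1_sol : bo_solution T s f u1) (u2_sol : bo_solution T s f u2) :
  ((exists Omega : set (R * R),
      [/\ open_cylinder T Omega, Omega !=set0 &
          forall x t : R, Omega (x, t) -> u1 t x = u2 t x]) ->
   forall x t : R, t \in `[0, T] -> u1 t x = u2 t x) /\
  ((exists Omega : set (R * R),
      [/\ open_cylinder T Omega, Omega !=set0 &
          forall x t : R, Omega (x, t) -> u1 t x = 0]) ->
   forall x t : R, t \in `[0, T] -> u1 t x = 0).
Proof.
split; case=> Omega [cyl ne0 eq12].
  exact: (eq_of_eq_on_open s_gt f_smooth u1_sol u2_sol T_gt0 cyl ne0 eq12).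
exact: (eq_of_eq_on_open s_gt f_smooth u1_sol (zero_solution T s f) T_gt0 cyl ne0 eq12).
Qed.
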